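(* Let $(X,d)$ be a compact metric space, $f:X\to X$ a continuous map, and $u:X\to\mathbb{R}$ a positive continuous function. (i) If $K\subset X$ is non-empty and compact, then $$\dim_{\rm BSP}K=\sup\{\overline P_\mu(f):\mu\in M(X),\ \mu(K)=1\}.$$ (ii) If $Z\subset X$ is analytic, then $$\dim_{\rm BSP}Z=\sup\{\dim_{\rm BSP}K: K\subset Z\text{ is compact}\}.$$
   Context: $M(X)$ is the set of Borel probability measures on $X$. A set is analytic if it is a continuous image of the space $\mathcal N$ of infinite sequences of natural numbers with its product topology. Bowen balls: for $n\in\mathbb{N}=\{1,2,\dots\}$, $d_n(x,y)=\max\{d(f^kx,f^ky):0\le k\le n-1\}$, $B_n(x,\varepsilon)=\{y: d_n(x,y)<\varepsilon\}$, $\overline B_n(x,\varepsilon)=\{y: d_n(x,y)\le\varepsilon\}$. A ball $B$ is regarded as carrying its length $n(B)=n$ and its center. Put $u(B)=\sup_{y\in B}\sum_{i=0}^{n(B)-1}u(f^iy)$. BS-packing dimension: for $Z\subset X$, $\alpha>0$, $N\in\mathbb{N}$, $\varepsilon>0$ let $P(Z,\alpha,\varepsilon,N)=\sup_{\mathcal G}\sum_{B\in\mathcal G}\exp(-\alpha u(B))$, the supremum over all finite or countable pairwise disjoint families $\mathcal G=\{\overline B_{n_i}(x_i,\varepsilon)\}$ with $x_i\in Z$, $n_i\ge N$ for all $i$. Let $P^*(Z,\alpha,\varepsilon)=\lim_{N\to\infty}P(Z,\alpha,\varepsilon,N)$ and $P(Z,\alpha,\varepsilon)=\inf\{\sum_{i=1}^\infty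 P^*(Z_i,\alpha,\varepsilon):\bigcup_{i=1}^\infty Z_i\supseteq Z\}$. Let $\dim_{\rm BSP}(Z,\varepsilon)=\inf\{\alpha:P(Z,\alpha,\varepsilon)=0\}=\sup\{\alpha:P(Z,\alpha,\varepsilon)=\infty\}$ and $\dim_{\rm BSP}Z=\lim_{\varepsilon\to0}\dim_{\rm BSP}(Z,\varepsilon)$. Measure-theoretical upper BS-dimension: for $\mu\in M(X)$, $$\overline P_\mu(f)=\int\overline P_\mu(f,x)\,d\mu(x),\qquad \overline P_\mu(f,x)=\lim_{\varepsilon\to0}\limsup_{n\to\infty}-\frac{\log\mu(B_n(x,\varepsilon))}{\sum_{i=0}^{n-1}u(f^ix)}.$$ *)

(* Defs.v *)
From HB Require Import structures.
From mathcomp Require Import all_boot all_order all_algebra.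
From mathcomp Require Import all_classical all_reals all_analysis.

Set Implicit Arguments.
Unset Strict Implicit.
Unset Printing Implicit Defensive.

Import Order.TTheory GRing.Theory Num.Theory.
Import numFieldNormedType.Exports.

Local Open Scope classical_set_scope.
Local Open Scope ring_scope.

(* Measurable types are pointed in the library, hence so is a metric space that
   carries Borel measures. *)
#[short(type="pmetricType")]
HB.structure Definition PointedMetric (K : numDomainType) :=
  {M of Metric K M & isPointed M}.

Definition borel (T : ptopologicalType) := g_sigma_algebraType (@open T).

Definition analytic (T : topologicalType) (A : set T) : Prop :=
  exists2 g : {ptws nat -> nat} -> T, continuous g & A = range g.

Section BowenBalls.
Context {R : realType} {X : metricType R}.
Variables (f : X -> X) (u : X -> R).

Definition bowen_dist (n : nat) (x y : X) : R :=
  \big[Num.max/0]_(k < n) mdist (iter k f x) (iter k f y).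

Definition bowen_ball (n : nat) (x : X) (e : R) : set X :=
  [set y | bowen_dist n x y < e].

Definition bowen_cball (n : nat) (x : X) (e : R) : set X :=
  [set y | bowen_dist n x y <= e].

Definition birkhoff_sum (n : nat) (x : X) : R := \sum_(i < n) u (iter i f x).

(* u(B) for the closed ball B of center x and length n. *)
Definition ball_weight (n : nat) (x : X) (e : R) : R :=
  sup [set birkhoff_sum n y | y in bowen_cball n x e].

End BowenBalls.

Section BSPackingDimension.
Context {R : realType} {X : metricType R}.
Variables (f : X -> X) (u : X -> R).
Local Open Scope ereal_scope.

(* A ball comes with its center and its length, so a family of balls is a set
   of pairs (center, length); distinct pairs index disjoint sets. *)
Definition packing (Z : set X) (e : R) (N : nat) (G : set (X * nat)) : Prop :=
  [/\ countable G,
      forall p, G p -> Z p.1 /\ (N <= p.2)%N &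
      trivIset G (fun p => bowen_cball f p.2 p.1 e)].

Definition packing_sup (Z : set X) (a e : R) (N : nat) : \bar R :=
  ereal_sup [set \esum_(p in G) (expR (- (a * ball_weight f u p.2 p.1 e)))%:E
            | G in packing Z e N].

Definition packing_premeasure (Z : set X) (a e : R) : \bar R :=
  limn (packing_sup Z a e).

Definition packing_measure (Z : set X) (a e : R) : \bar R :=
  ereal_inf [set \sum_(0 <= i <oo) packing_premeasure (Zs i) a e
            | Zs in [set Zs : nat -> set X | Z `<=` \bigcup_i Zs i]].

Definition dimBSP_at (Z : set X) (e : R) : \bar R :=
  ereal_inf [set a%:E | a in [set a : R | (0 < a)%R /\
                                          packing_measure Z a e = 0]].

Definition dimBSP (Z : set X) : \bar R :=
  lim (dimBSP_at Z e @[e --> 0^'+]).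

End BSPackingDimension.

Section UpperBSDimension.
Context {R : realType} {X : pmetricType R}.
Variables (f : X -> X) (u : X -> R).
Local Open Scope ereal_scope.

Definition upper_local_BS (mu : probability (borel X) R) (x : X) : \bar R :=
  lim (limn_esup (fun n => - lne (mu (bowen_ball f n x e))
                           / (birkhoff_sum f u n x)%:E) @[e --> 0^'+]).

Definition upper_BS (mu : probability (borel X) R) : \bar R :=
  \int[mu]_x upper_local_BS mu x.

End UpperBSDimension.

(* Main.v *)
Require Import Defs.
From HB Require Import structures.
From mathcomp Require Import all_boot all_order all_algebra.
From mathcomp Require Import all_classical all_reals all_analysis.
From mathcomp Require Import measurable_realfun.
From mathcomp Require Import ring lra.

Set Implicit Arguments.
Unset Strict Implicit.
Unset Printing Implicit Defensive.

Import Order.TTheory GRing.Theory Num.Theory.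
Import numFieldNormedType.Exports.

Local Open Scope classical_set_scope.
Local Open Scope ring_scope.

(** The packing measure at a fixed radius enters only through the notion of a
    thin set: a set covered by countably many sets of finite packing
    premeasure.  Passing from an exponent to a larger one turns finite
    premeasure into zero premeasure ([packing_premeasure_eq0]), because long
    balls have large weight; hence [dimBSP_at Z e] is the infimum of the
    exponents at which [Z] is thin ([thin_dimBSP_at], [dimBSP_at_thin]).

    Upper bound ([upper_BS_le_dimBSP]).  If [Z] has finite packing premeasure at
    the exponent [a] and [a < t], the points of [Z] whose Bowen ball of length
    [n] and radius [3 * e] has measure less than [exp (- t S_n u)] are covered by
    enlarging a maximal disjoint family of closed balls of radius [e].  By
    uniform continuity of [u], for small [e] this cover has measure at most
    [r * exp (- n d)] for some [d > 0].  By the Borel-Cantelli lemma the local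
    rate is at most [t] almost everywhere on [Z], hence on any thin set, and the
    integral of the local rates is at most the dimension.

    Lower bound ([not_thin_measure]).  Let [h : seq nat -> set X] be a
    scheme of sets, each piece [h l] being covered by the pieces [h (rcons l k)],
    and suppose that [h [::]] is not thin at the exponent [a].
    Removing a thin part leaves points all of whose neighbourhoods meet a piece
    of the next generation in a non-thin set ([not_thin_core]).  The remaining
    set has infinite premeasure, so it contains the centers of a finite
    disjoint family of arbitrarily long balls of total weight as large as
    desired.  Iterating in small balls around these centers gives a finitely
    branching tree of cells, distinct siblings staying apart in the Bowen metrics
    after small perturbations, in which the weights of the children of a node add
    up to at least its own ([ex_children]).  Cutting the unit interval greedily
    along the tree sends Lebesgue measure to a probability measure on a compact
    set of limits of branches; if the Bowen ball of radius [e] centered at such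
    a limit has the length attached to a node of its branch, the preimage of
    this ball lies in an interval whose length is the weight of that node, so
    the local rate is at least [a] on that compact set.

    A constant scheme gives the statement for a compact set, and the images of
    the cylinders of the Baire space give the one for an analytic set. *)

(** * Bowen metrics and Birkhoff sums *)

Lemma near0r_ex {R : realType} (P : R -> Prop) :
  (\forall d \near 0^'+, P d) -> exists2 d, 0 < d & P d.
Proof.
move=> nP; near (0:R)^'+ => d; exists d; near: d; last exact: nP.
exact: nbhs_right_gt.
Unshelve. all: by end_near. Qed.

Section BowenMetric.
Context {R : realType} {X : metricType R}.
Variable f : X -> X.
Implicit Types (x y z : X) (n : nat) (e : R).

Lemma bowen_dist_leP n x y e : 0 <= e ->
  reflect (forall k, (k < n)%N -> mdist (iter k f x) (iter k f y) <= e)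
          (bowen_dist f n x y <= e).
Proof.
move=> e0; apply: (iffP idP) => [h k kn|h].
  by apply: le_trans h; rewrite (le_bigmax _ _ (Ordinal kn)).
by apply: bigmax_le => // i _; exact: h.
Qed.

Lemma bowen_dist_ge0 n x y : 0 <= bowen_dist f n x y.
Proof. exact: bigmax_ge_id. Qed.

Lemma bowen_distxx n x : bowen_dist f n x x = 0.
Proof.
apply/eqP; rewrite eq_le bowen_dist_ge0 andbT.
by apply/bowen_dist_leP => // k _; rewrite mdistxx.
Qed.

Lemma bowen_dist_sym n x y : bowen_dist f n x y = bowen_dist f n y x.
Proof. by apply: eq_bigr => k _; rewrite metric_sym. Qed.

Lemma bowen_dist_triangle n x y z :
  bowen_dist f n x z <= bowen_dist f n x y + bowen_dist f n y z.
Proof.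
apply/bowen_dist_leP => [|k kn]; first by rewrite addr_ge0 ?bowen_dist_ge0.
apply: (le_trans (metric_triangle _ (iter k f y) _)).
by rewrite lerD //; apply: (elimT (bowen_dist_leP _ _ _ _) _ k kn);
  rewrite ?bowen_dist_ge0.
Qed.

Lemma bowen_dist_homo n m x y :
  (n <= m)%N -> bowen_dist f n x y <= bowen_dist f m x y.
Proof.
move=> nm; apply/bowen_dist_leP => [|k kn]; first exact: bowen_dist_ge0.
by apply: (elimT (bowen_dist_leP _ _ _ _) _ k (leq_trans kn nm));
  rewrite ?bowen_dist_ge0.
Qed.

Lemma bowen_cballxx n x e : 0 <= e -> bowen_cball f n x e x.
Proof. by move=> e0; rewrite /bowen_cball/= bowen_distxx. Qed.

Lemma bowen_ballxx n x e : 0 < e -> bowen_ball f n x e x.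
Proof. by move=> e0; rewrite /bowen_ball/= bowen_distxx. Qed.

Hypothesis fcont : continuous f.

Lemma iter_continuous k : continuous (iter k f).
Proof.
elim: k => [|k IH] x; first exact: cvg_id.
by apply: (@continuous_comp _ _ _ (iter k f) f); [exact: IH|exact: fcont].
Qed.

Lemma near_bowen_dist n x e : 0 < e ->
  \forall d \near 0^'+, forall z, mdist x z <= d -> bowen_dist f n x z <= e.
Proof.
move=> e0.
suff [d d0 dP] : exists2 d : R, 0 < d &
    forall z, mdist x z < d -> bowen_dist f n x z <= e.
  near=> r => z zr; apply: dP; apply: le_lt_trans zr _.
  by near: r; exact: nbhs_right_lt.
elim: n => [|n [d d0 IH]].
  by exists 1 => // z _; rewrite /bowen_dist big_ord0 ltW.
have /(@iter_continuous n x) : nbhs (iter n f x) (ball (iter n f x) e).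
  exact: nbhsx_ballx.
rewrite nbhs_simpl -filter_from_ballE => -[d' d'0 d'P].
exists (Num.min d d'); first by rewrite lt_min d0.
move=> z; rewrite lt_min => /andP[zd zd'].
apply/bowen_dist_leP => [|k]; first exact: ltW.
rewrite ltnS leq_eqVlt => /predU1P[->|kn].
  have /d'P : ball x d' z by rewrite ballEmdist.
  by rewrite /= ballEmdist => /ltW.
by apply: (elimT (bowen_dist_leP _ _ _ (ltW e0)) (IH _ zd)).
Unshelve. all: by end_near. Qed.

Lemma open_bowen_ball n x e : open (bowen_ball f n x e).
Proof.
rewrite openE => y; rewrite /bowen_ball/= => xy.
pose r := (e - bowen_dist f n x y) / 2.
have r0 : 0 < r by rewrite divr_gt0// subr_gt0.
have [d d0 dP] := near0r_ex (near_bowen_dist n y r0).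
rewrite /interior -nbhs_ballE/=; exists d => //= z; rewrite ballEmdist/=.
move=> /ltW/dP yz; apply: le_lt_trans (bowen_dist_triangle _ _ y _) _.
by move: yz; rewrite /r; lra.
Qed.

End BowenMetric.

Section BallWeight.
Context {R : realType} {X : metricType R}.
Variables (f : X -> X) (u : X -> R) (c M : R).
Hypotheses (cu : forall x, c <= u x) (uM : forall x, u x <= M).
Implicit Types (x y z : X) (n : nat) (e : R).

Lemma birkhoff_sum_ge n x : n%:R * c <= birkhoff_sum f u n x.
Proof.
rewrite mulr_natl -[n in c *+ n]card_ord -sumr_const.
by apply: ler_sum => i _; exact: cu.
Qed.

Lemma birkhoff_sum_le n x : birkhoff_sum f u n x <= n%:R * M.
Proof.
rewrite mulr_natl -[n in M *+ n]card_ord -sumr_const.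
by apply: ler_sum => i _; exact: uM.
Qed.

Lemma ball_weight_has_sup n x e : 0 <= e ->
  has_sup [set birkhoff_sum f u n y | y in bowen_cball f n x e].
Proof.
move=> e0; split.
  by exists (birkhoff_sum f u n x); exists x => //; exact: bowen_cballxx.
by exists (n%:R * M) => _ [y _ <-]; exact: birkhoff_sum_le.
Qed.

Lemma birkhoff_sum_le_ball_weight n x y e : 0 <= e -> bowen_cball f n x e y ->
  birkhoff_sum f u n y <= ball_weight f u n x e.
Proof.
move=> e0 xy; apply: sup_upper_bound; first exact: ball_weight_has_sup.
by exists y.
Qed.

Lemma ball_weight_le n x e b : 0 <= e ->
  (forall y, bowen_cball f n x e y -> birkhoff_sum f u n y <= b) ->
  ball_weight f u n x e <= b.
Proof.
move=> e0 h; apply: ge_sup; first exact: (ball_weight_has_sup n x e0).1.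
by move=> _ [y xy <-]; exact: h.
Qed.

Lemma ball_weight_ge n x e : 0 <= e -> n%:R * c <= ball_weight f u n x e.
Proof.
move=> e0; apply: le_trans (birkhoff_sum_ge n x) _.
by apply: birkhoff_sum_le_ball_weight => //; exact: bowen_cballxx.
Qed.

Lemma ball_weight_homo n x e e' : 0 <= e -> e <= e' ->
  ball_weight f u n x e <= ball_weight f u n x e'.
Proof.
move=> e0 ee'; apply: ball_weight_le => // y xy.
apply: birkhoff_sum_le_ball_weight; first exact: le_trans ee'.
exact: le_trans ee'.
Qed.

End BallWeight.

Lemma compact_positive_bounds {R : realType} {X : pmetricType R} (u : X -> R) :
  compact [set: X] -> continuous u -> (forall x, 0 < u x) ->
  exists c M, [/\ 0 < c, forall x, c <= u x & forall x, u x <= M].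
Proof.
move=> Xc uc u0.
have X0 : [set: X] !=set0 by exists point.
have [|b _ bM] := compact_EVT_max (f := u) X0 Xc; first exact: continuous_subspaceT.
have [|a _ am] := compact_EVT_min (f := u) X0 Xc; first exact: continuous_subspaceT.
by exists (u a), (u b); split => // x; [apply: am|apply: bM]; rewrite inE.
Qed.

Lemma compact_uniform_modulus {R : realType} {X : pmetricType R} (u : X -> R)
    (e : R) : compact [set: X] -> continuous u -> 0 < e ->
  exists2 d, 0 < d & forall x y, mdist x y <= d -> `|u x - u y| <= e.
Proof.
move=> Xc uc e0; apply: near0r_ex.
pose P d x := forall y, mdist x y <= d -> `|u x - u y| <= e.
suff : \forall d \near (0:R)^'+, [set: X] `<=` P d.
  by apply: filterS => d dP x y; exact: dP.
apply: (compact_near_coveringP _).1 Xc _ _ _ _ _ => x _.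
have e20 : 0 < e / 2 by rewrite divr_gt0.
have : nbhs (u x) (ball (u x) (e / 2)) by exact: nbhsx_ballx.
move=> /uc; rewrite nbhs_simpl -filter_from_ballE => -[d d0 dP].
have d20 : 0 < d / 2 by rewrite divr_gt0.
have du z : mdist x z < d -> `|u x - u z| < e / 2.
  by move=> xz; have /dP : ball x d z by rewrite ballEmdist.
exists (ball x (d / 2), [set r : R | r < d / 2]).
  by split; [exact: nbhsx_ballx|exact: nbhs_right_lt].
move=> [y r] /= []; rewrite ballEmdist/= => xy rd z yz.
have xz : mdist x z < d.
  by apply: le_lt_trans (metric_triangle x y z) _; lra.
have xyd : mdist x y < d by lra.
have := du _ xz; have := du _ xyd; rewrite !ltr_norml ler_norml; lra.
Qed.

(** * The packing dimension through sigma-finite packing premeasure *)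

(** A set is thin when it is covered by countably many sets of finite packing
    premeasure.  Thin sets are stable under countable unions for free, and
    [dimBSP_at Z e] is the infimum of the exponents at which [Z] is thin, so
    thinness replaces the nullity of the packing measure. *)
Definition thin {R : realType} {X : metricType R} (f : X -> X) (u : X -> R)
    (Z : set X) (a e : R) :=
  exists2 Zs : nat -> set X, Z `<=` \bigcup_i Zs i &
    forall i, (packing_premeasure f u (Zs i) a e < +oo)%E.

Lemma ereal_between {R : realType} (x y : \bar R) : (0 <= x -> x < y ->
  exists2 a : R, (0 < a)%R && (x < a%:E) & a%:E < y)%E.
Proof.
case: x => [r| |]// r0; case: y => [s| |]// rs.
  exists ((r + s) / 2); last by rewrite lte_fin midf_lt.
  rewrite !lee_fin !lte_fin in r0 rs *; rewrite midf_lt// andbT.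
  by rewrite divr_gt0// ltr_wpDl// (le_lt_trans r0).
exists (r + 1); last by rewrite ltry.
by rewrite lte_fin ltrDl ltr01 andbT ltr_wpDl// -lee_fin.
Qed.

Section Packing.
Context {R : realType} {X : metricType R}.
Variables (f : X -> X) (u : X -> R) (c M : R).
Hypotheses (c0 : 0 < c) (cu : forall x, c <= u x) (uM : forall x, u x <= M).
Implicit Types (Z : set X) (a b e : R) (N n : nat).
Local Open Scope ereal_scope.

Lemma packing_sup_nonincreasing Z a e :
  {homo packing_sup f u Z a e : m n / (m <= n)%N >-> n <= m}.
Proof.
move=> m n mn; apply: ereal_sup_le => _ [G [cG ZG tG] <-]; exists G => //.
by split => // p /ZG[Zp np]; split => //; exact: leq_trans np.
Qed.

Lemma packing_premeasureE Z a e :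
  packing_premeasure f u Z a e = ereal_inf (range (packing_sup f u Z a e)).
Proof.
apply: cvg_lim => //; apply: ereal_nonincreasing_cvgn.
exact: packing_sup_nonincreasing.
Qed.

Lemma packing_sup_ge0 Z a e N : 0 <= packing_sup f u Z a e N.
Proof.
apply: ereal_sup_ubound; exists set0; last by rewrite esum_set0.
by split => //; exact: trivIset_set0.
Qed.

Lemma packing_premeasure_ge0 Z a e : 0 <= packing_premeasure f u Z a e.
Proof.
rewrite packing_premeasureE; apply: le_ereal_inf_tmp => _ [N _ <-].
exact: packing_sup_ge0.
Qed.

Lemma packing_premeasure_lty Z a e : packing_premeasure f u Z a e < +oo ->
  exists N r, packing_sup f u Z a e N <= r%:E.
Proof.
rewrite packing_premeasureE => /ereal_inf_lt[_ [N _ <-]] h.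
exists N, (fine (packing_sup f u Z a e N)); rewrite fineK//.
by rewrite ge0_fin_numE ?packing_sup_ge0.
Qed.

Lemma packing_premeasure_set0 a e : packing_premeasure f u set0 a e = 0.
Proof.
apply/eqP; rewrite eq_le packing_premeasure_ge0 andbT packing_premeasureE.
apply: (@le_trans _ _ (packing_sup f u set0 a e 0)).
  by apply: ereal_inf_lbound; exists 0%N.
apply: ge_ereal_sup => _ [G [_ G0 _] <-]; suff -> : G = set0 by rewrite esum_set0.
by rewrite -subset0 => p /G0[].
Qed.

Lemma packing_premeasure_eq0 Z a b e : (0 <= e)%R -> (a < b)%R ->
  packing_premeasure f u Z a e < +oo -> packing_premeasure f u Z b e = 0.
Proof.
move=> e0 ab /packing_premeasure_lty[N0 [r hr]].
have r0 : (0 <= r)%R by rewrite -lee_fin (le_trans _ hr)// packing_sup_ge0.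
apply/eqP; rewrite eq_le packing_premeasure_ge0 andbT.
apply/lee_addgt0Pr => d d0; rewrite add0e.
pose k := ((b - a) * c)%R.
have k0 : (0 < k)%R by rewrite mulr_gt0 ?subr_gt0.
(* the factor expR (- k N) gained on balls of length at least N *)
pose N := maxn N0 (Num.truncn (r / (k * d))).+1.
have rN : (expR (- (k * N%:R)) * r <= d)%R.
  have N1 : (r / (k * d) < N%:R)%R.
    rewrite (lt_le_trans (truncnS_gt _))// ler_nat leq_maxr//.
  rewrite expRN mulrC ler_pdivrMr ?expR_gt0//.
  apply: le_trans (_ : d * (k * N%:R) <= _)%R.
    by rewrite ltr_pdivrMr ?mulr_gt0// in N1; lra.
  rewrite ler_pM2l//; apply: le_trans (expR_ge1Dx _); lra.
rewrite packing_premeasureE; apply: (@le_trans _ _ (packing_sup f u Z b e N)).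
  by apply: ereal_inf_lbound; exists N.
apply: (@le_trans _ _ (expR (- (k * N%:R)) * r)%:E); last by rewrite lee_fin.
apply: ge_ereal_sup => _ [G [cG ZG tG] <-].
apply: ge_ereal_sup => _ [A [finA AG] <-].
apply: (@le_trans _ _ ((expR (- (k * N%:R)))%:E *
    \sum_(p \in A) (expR (- (a * ball_weight f u p.2 p.1 e)))%:E)); last first.
  rewrite EFinM lee_pmul2l// ?lte_fin ?expR_gt0//; apply: le_trans hr.
  rewrite -esum_fset//; apply: ereal_sup_ubound; exists A => //.
  split; first exact: finite_set_countable.
    move=> p /AG/ZG[Zp Np]; split => //; apply: leq_trans Np; exact: leq_maxl.
  exact: sub_trivIset tG.
rewrite ge0_mule_fsumr => [|p]; last by rewrite lee_fin expR_ge0.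
apply: lee_fsum => // p /AG/ZG[_ Np].
rewrite -EFinM lee_fin -expRD ler_expR.
have := ball_weight_ge f cu uM p.2 p.1 e0.
have : (N%:R <= p.2%:R :> R)%R by rewrite ler_nat.
set w := ball_weight _ _ _ _ _; set m := p.2%:R => Nm mw.
have : (N%:R * c <= w)%R by apply: le_trans mw; rewrite ler_pM2r.
by rewrite /k; nra.
Qed.

Lemma thin_sub Z Z' a e : Z `<=` Z' -> thin f u Z' a e -> thin f u Z a e.
Proof. by move=> ZZ' [Zs Z'Zs fZs]; exists Zs => //; exact: subset_trans Z'Zs. Qed.

Lemma thin_set0 a e : thin f u set0 a e.
Proof. by exists (fun=> set0) => // i; rewrite packing_premeasure_set0. Qed.

Lemma thin_bigcup (Z : nat -> set X) a e :
  (forall i, thin f u (Z i) a e) -> thin f u (\bigcup_i Z i) a e.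
Proof.
move=> tZ; have [Zs ZZs fZs] := all_sig2 (fun i => cid2 (tZ i)).
pose pr n := odflt (0%N, 0%N) (unpickle n : option (nat * nat)).
exists (fun n => Zs (pr n).1 (pr n).2) => // x [i _ /ZZs[j _ xij]].
by exists (pickle (i, j)) => //; rewrite /pr pickleK.
Qed.

Lemma thin_setU Z Z' a e :
  thin f u Z a e -> thin f u Z' a e -> thin f u (Z `|` Z') a e.
Proof.
move=> tZ tZ'; apply: (@thin_sub _ (\bigcup_i if i == 0%N then Z else Z')).
  by move=> x [Zx|Z'x]; [exists 0%N|exists 1%N].
by apply: thin_bigcup => -[].
Qed.

Lemma packing_premeasure_antitone Z a e e' : (0 <= a)%R -> (0 <= e <= e')%R ->
  packing_premeasure f u Z a e' <= packing_premeasure f u Z a e.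
Proof.
move=> a0 /andP[e0 ee']; rewrite !packing_premeasureE.
apply: le_ereal_inf_tmp => _ [N _ <-].
apply: (@le_trans _ _ (packing_sup f u Z a e' N)).
  by apply: ereal_inf_lbound; exists N.
apply: ge_ereal_sup => _ [G [cG ZG tG] <-].
apply: (@le_trans _ _
  (\esum_(p in G) (expR (- (a * ball_weight f u p.2 p.1 e)))%:E)); last first.
  apply: ereal_sup_ubound; exists G => //; split => // p q Gp Gq [x [px qx]].
  by apply: tG => //; exists x; split; exact: le_trans ee'.
apply: le_esum => p _; rewrite lee_fin ler_expR lerN2 ler_wpM2l//.
exact: (ball_weight_homo f uM).
Qed.

Lemma thin_dimBSP_at Z a e :
  (0 <= e)%R -> (0 < a)%R -> thin f u Z a e -> dimBSP_at f u Z e <= a%:E.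
Proof.
move=> e0 a0 [Zs ZZs fZs]; apply/lee_addgt0Pr => d d0.
apply: ereal_inf_lbound; exists (a + d)%R => //; split; first exact: addr_gt0.
apply/eqP; rewrite eq_le; apply/andP; split; last first.
  apply: le_ereal_inf_tmp => _ [Ys _ <-].
  by apply: nneseries_ge0 => i _ _; exact: packing_premeasure_ge0.
apply: ereal_inf_lbound; exists Zs => //.
by apply: eseries0 => i _ _; apply: (packing_premeasure_eq0 e0 _ (fZs i)); lra.
Qed.

Lemma dimBSP_at_thin Z t e : dimBSP_at f u Z e < t%:E ->
  exists2 a, (0 < a < t)%R & thin f u Z a e.
Proof.
move=> /ereal_inf_lt[_ [a [a0 Pa] <-]]; rewrite lte_fin => at_.
exists a; first by rewrite a0.
have /ereal_inf_lt[_ [Zs ZZs <-]] : packing_measure f u Z a e < 1 by rewrite Pa.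
move=> sum1; exists Zs => // i.
have P0 n : true -> 0 <= packing_premeasure f u (Zs n) a e.
  by rewrite packing_premeasure_ge0.
apply: le_lt_trans (lt_trans sum1 (ltry _)).
apply: le_trans (nneseries_lim_ge i.+1 _); last by move=> n _; exact: P0.
by rewrite big_nat_recr//= leeDr// sume_ge0.
Qed.

Lemma dimBSP_at_ge0 Z e : 0 <= dimBSP_at f u Z e.
Proof. by apply: le_ereal_inf_tmp => _ [a [a0 _] <-]; rewrite lee_fin ltW. Qed.

Lemma le_dimBSP_at_thin Z Z' e e' : (0 <= e)%R ->
  (forall a, (0 < a)%R -> thin f u Z' a e' -> thin f u Z a e) ->
  dimBSP_at f u Z e <= dimBSP_at f u Z' e'.
Proof.
move=> e0 h; rewrite leNgt; apply/negP => lt_dim.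
have [t /andP[_ /dimBSP_at_thin[a /andP[a0 a_t] Z'thin]] tZ] :=
  ereal_between (dimBSP_at_ge0 Z' e') lt_dim.
have := thin_dimBSP_at e0 a0 (h _ a0 Z'thin).
by rewrite leNgt => /negP; apply; apply: lt_trans tZ; rewrite lte_fin.
Qed.

Lemma dimBSP_at_antitone Z e e' : (0 < e <= e')%R ->
  dimBSP_at f u Z e' <= dimBSP_at f u Z e.
Proof.
move=> /andP[e0 ee']; apply: le_dimBSP_at_thin => [|a a0 [Zs ZZs fZs]].
  exact/ltW/(lt_le_trans e0).
exists Zs => [|i]; first exact: ZZs.
apply: (@le_lt_trans _ _ _ _ _ _ (fZs i)).
by apply: packing_premeasure_antitone; rewrite (ltW a0, ltW e0).
Qed.

End Packing.

(** * Limits in the radius and upper limits in the length *)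

Section Limits.
Context {R : realType}.
Local Open Scope ereal_scope.

Lemma antitone_lim0 (phi : R -> \bar R) :
  (forall e e', (0 < e <= e')%R -> phi e' <= phi e) ->
  lim (phi e @[e --> 0^'+]) = ereal_sup [set phi e | e in [set e | (0 < e)%R]].
Proof.
move=> phiP; have -> : [set e : R | (0 < e)%R] = [set` `]0%R, +oo[].
  by apply/seteqP; split => e /=; rewrite in_itv/= andbT.
apply: cvg_lim => //; apply: nonincreasing_at_right_cvge => // e e'.
by rewrite !in_itv/= !andbT => e0 _ ee'; rewrite phiP// e0.
Qed.

(** Exceedances of a value below the upper limit occur arbitrarily late. *)
Lemma limn_esup_gt (v : (\bar R)^nat) t N :
  t < limn_esup v -> exists2 n, (N <= n)%N & t < v n.
Proof.
move=> tv; have : t < ereal_sup (v @` [set n | (N <= n)%N]).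
  apply: lt_le_trans tv _; apply: ereal_inf_lbound.
  by exists [set n | (N <= n)%N] => //; exists N.
by move=> /ereal_sup_gt[_ [n Nn <-]]; exists n.
Qed.

Lemma limn_esup_ge (v : (\bar R)^nat) t :
  (forall N, exists2 n, (N <= n)%N & t <= v n) -> t <= limn_esup v.
Proof.
move=> h; apply: le_ereal_inf_tmp => _ [V [N _ NV] <-].
have [n Nn tn] := h N; apply: le_trans tn _; apply: ereal_sup_ubound.
by exists n => //; exact: NV.
Qed.

Lemma limn_esup_homo (v w : (\bar R)^nat) :
  (forall n, v n <= w n) -> limn_esup v <= limn_esup w.
Proof.
move=> vw; apply: le_ereal_inf_tmp => _ [V FV <-].
apply: (@le_trans _ _ (ereal_sup (v @` V))).
  by apply: ereal_inf_lbound; exists V.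
apply: ge_ereal_sup => _ [n Vn <-]; apply: le_trans (vw n) _.
by apply: ereal_sup_ubound; exists n.
Qed.

Lemma lt_lne_div (p : \bar R) (t S : R) : 0 <= p -> (0 < S)%R ->
  (t%:E < - lne p / S%:E) = (p < (expR (- (t * S)))%:E).
Proof.
move=> p0 S0; rewrite inver gt_eqF// lte_pdivlMr// -EFinM lteNr -EFinN.
rewrite -[X in _ < X%:E]expRK -lne_EFin ?expR_gt0// lte_lne//.
  by rewrite in_itv/= p0 leey.
by rewrite in_itv/= leey lee_fin expR_ge0.
Qed.

Lemma le_lne_div (p : \bar R) (t S : R) : 0 <= p -> (0 < S)%R ->
  (t%:E <= - lne p / S%:E) = (p <= (expR (- (t * S)))%:E).
Proof.
move=> p0 S0; rewrite inver gt_eqF// lee_pdivlMr// -EFinM leeNr -EFinN.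
rewrite -[X in _ <= X%:E]expRK -lne_EFin ?expR_gt0// lee_lne//.
  by rewrite in_itv/= p0 leey.
by rewrite in_itv/= leey lee_fin expR_ge0.
Qed.

End Limits.

(** The inner upper limit of [upper_local_BS], at a fixed radius. *)
Definition local_rate {R : realType} {X : pmetricType R} (f : X -> X)
    (u : X -> R) (mu : probability (borel X) R) (x : X) (e : R) : \bar R :=
  limn_esup (fun n => - lne (mu (bowen_ball f n x e))
                      / (birkhoff_sum f u n x)%:E)%E.

Section Dimensions.
Context {R : realType} {X : pmetricType R}.
Variables (f : X -> X) (u : X -> R) (c M : R).
Hypotheses (c0 : 0 < c) (cu : forall x, c <= u x) (uM : forall x, u x <= M).
Implicit Types (Z : set X) (mu : probability (borel X) R).
Local Open Scope ereal_scope.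

Lemma dimBSPE Z : dimBSP f u Z =
  ereal_sup [set dimBSP_at f u Z e | e in [set e | (0 < e)%R]].
Proof.
apply: antitone_lim0 => e e' ee'; exact: (dimBSP_at_antitone f c0 cu uM).
Qed.

Lemma dimBSP_ge0 Z : 0 <= dimBSP f u Z.
Proof.
rewrite dimBSPE; apply: (le_trans (dimBSP_at_ge0 f u Z 1)).
by apply: ereal_sup_ubound; exists 1%R => /=.
Qed.

Lemma dimBSP_subset Z Z' : Z `<=` Z' -> dimBSP f u Z <= dimBSP f u Z'.
Proof.
move=> ZZ'; rewrite !dimBSPE; apply: ge_ereal_sup => _ [e /= e0 <-].
apply: (@le_trans _ _ (dimBSP_at f u Z' e)).
  apply: (le_dimBSP_at_thin (f := f) c0 cu uM) => [|a _]; first exact: ltW.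
  exact: thin_sub.
by apply: ereal_sup_ubound; exists e.
Qed.

Hypothesis fcont : continuous f.

Lemma open_measurable_borel (U : set X) :
  open U -> measurable (U : set (borel X)).
Proof. exact: sub_sigma_algebra. Qed.

Lemma closed_measurable_borel (C : set X) :
  closed C -> measurable (C : set (borel X)).
Proof.
move=> Ccl; rewrite -(setCK C); apply: measurableC.
by apply: open_measurable_borel; exact: closed_openC.
Qed.

Lemma measurable_bowen_ball n x e :
  measurable (bowen_ball f n x e : set (borel X)).
Proof. by apply: open_measurable_borel; exact: open_bowen_ball. Qed.

Lemma birkhoff_sum_ge0 n x : (0 <= birkhoff_sum f u n x)%R.
Proof. by apply: sumr_ge0 => i _; rewrite ltW// (lt_le_trans c0). Qed.

Lemma birkhoff_sum_gt0 n x : (0 < n)%N -> (0 < birkhoff_sum f u n x)%R.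
Proof.
move=> n0; apply: lt_le_trans (birkhoff_sum_ge f cu n x).
by rewrite mulr_gt0// ltr0n.
Qed.

Lemma local_rate_ge0 mu x e : 0 <= local_rate f u mu x e.
Proof.
apply: limn_esup_ge => N; exists N => //; apply: mule_ge0.
  rewrite leeNr oppe0 lne_le0; apply: probability_le1.
  exact: measurable_bowen_ball.
by rewrite inve_ge0 lee_fin birkhoff_sum_ge0.
Qed.

Lemma local_rate_antitone mu x e e' : (0 < e <= e')%R ->
  local_rate f u mu x e' <= local_rate f u mu x e.
Proof.
move=> /andP[e0 ee']; apply: limn_esup_homo => n; apply: lee_wpmul2r.
  by rewrite inve_ge0 lee_fin birkhoff_sum_ge0.
rewrite leeN2 lee_lne ?in_itv/= ?measure_ge0 ?leey//.
apply: le_measure; rewrite ?inE; try exact: measurable_bowen_ball.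
by move=> y xy; apply: lt_le_trans xy ee'.
Qed.

Lemma upper_local_BSE mu x : upper_local_BS f u mu x =
  ereal_sup [set local_rate f u mu x e | e in [set e | (0 < e)%R]].
Proof. by apply: antitone_lim0 => e e'; exact: local_rate_antitone. Qed.

Lemma upper_local_BS_ge0 mu x : 0 <= upper_local_BS f u mu x.
Proof.
rewrite upper_local_BSE; apply: (le_trans (local_rate_ge0 mu x 1)).
by apply: ereal_sup_ubound; exists 1%R => /=.
Qed.

End Dimensions.

(** * Measures carried by a set have local rates bounded by its dimension *)

Section UpperBound.
Context {R : realType} {X : pmetricType R}.
Variables (f : X -> X) (u : X -> R) (c M : R).
Hypotheses (Xcompact : compact [set: X]) (fcont : continuous f).
Hypotheses (c0 : 0 < c) (cu : forall x, c <= u x) (uM : forall x, u x <= M).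
Variable mu : probability (borel X) R.
Implicit Types (Z D E : set X) (n : nat).
Local Open Scope ereal_scope.

(** Cover by finitely many Bowen balls of half the radius: each contains at most
    one center. *)
Lemma finite_disjoint_bowen_cballs E n e : (0 < e)%R ->
  trivIset E (fun y => bowen_cball f n y e) -> finite_set E.
Proof.
move=> e0 tE; move: Xcompact; rewrite compact_cover.
have e20 : (0 < e / 2)%R by rewrite divr_gt0.
move=> /(_ X setT (fun x => bowen_ball f n x (e / 2))).
case=> [x _||C _ XC]; first exact: open_bowen_ball.
  by move=> x _; exists x => //; exact: bowen_ballxx.
have [F finF XF] : exists2 F : set X, finite_set F &
    [set: X] `<=` \bigcup_(x in F) bowen_ball f n x (e / 2).
  by eexists; last exact: XC; exact: finite_fset.
have EF : E `<=` \bigcup_(x in F) (E `&` bowen_ball f n x (e / 2)).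
  by move=> y Ey; have [x Fx xy] := XF y Logic.I; exists x.
apply: (sub_finite_set EF).
apply: bigcup_finite => // x _.
have [->|/set0P[y [Ey xy]]] := eqVneq (E `&` bowen_ball f n x (e / 2)) set0.
  exact: finite_set0.
apply: (@sub_finite_set _ _ [set y]) => [z [Ez xz]|]; last exact: finite_set1.
apply: tE => //.
exists z; split; rewrite /bowen_cball/=; first by rewrite bowen_distxx ltW.
apply: le_trans (bowen_dist_triangle _ _ _ x _) _; rewrite bowen_dist_sym.
by move: xy xz; rewrite /bowen_ball/=; lra.
Qed.

(** The covering lemma at a fixed length: a maximal family of disjoint balls
    covers once the radius is enlarged. *)
Lemma bowen_covering D n e : (0 < e)%R ->
  exists E, [/\ E `<=` D, finite_set E,
    trivIset E (fun y => bowen_cball f n y e) &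
    D `<=` \bigcup_(y in E) bowen_ball f n y (3 * e)].
Proof.
move=> e0.
have [E [ED tE maxE]] :=
  ex_maximal_disjoint_subcollection (fun y => bowen_cball f n y e) D.
exists E; split => //; first exact: finite_disjoint_bowen_cballs tE.
move=> x Dx; apply: contrapT => xE.
have disj y : E y -> bowen_cball f n x e `&` bowen_cball f n y e = set0.
  move=> Ey; rewrite -subset0 => z [xz yz]; apply: xE; exists y => //.
  rewrite /bowen_ball/=; apply: le_lt_trans (bowen_dist_triangle _ _ _ z _) _.
  by rewrite (bowen_dist_sym f n z x); move: xz yz; rewrite /bowen_cball/=; lra.
apply: (maxE (x |` E)); last first.
- move=> y z [->|Ey] [->|Ez] //.
  + by rewrite disj// => -[].
  + by rewrite setIC disj// => -[].
  + exact: tE.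
- by move=> y [->|/ED].
- split; first by move=> y Ey; right.
  move=> /(_ x (or_introl erefl)) Ex; apply: xE; exists x => //.
  by apply: bowen_ballxx; lra.
Qed.

(** The points with a Bowen ball of length [n] of small measure lie in a set of
    measure exponentially small in [n]. *)
Lemma mu_small_balls_le Z a e t d N r n : (0 < e)%R -> (0 < n)%N -> (N <= n)%N ->
  (forall y, a * ball_weight f u n y e + n%:R * d <= t * birkhoff_sum f u n y)%R ->
  packing_sup f u Z a e N <= r%:E ->
  exists U : set X, [/\ measurable (U : set (borel X)),
    mu U <= (r * expR (- d) ^+ n)%:E &
    [set x | Z x /\ t%:E < - lne (mu (bowen_ball f n x (3 * e)))
                           / (birkhoff_sum f u n x)%:E] `<=` U].
Proof.
move=> e0 n0 Nn ht hr; set D := [set x | _].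
have [E [ED finE tE DE]] := bowen_covering D n e0.
have mB y : measurable (bowen_ball f n y (3 * e) : set (borel X)).
  exact: measurable_bowen_ball.
have mU : measurable
    (\bigcup_(y in E) bowen_ball f n y (3 * e) : set (borel X)).
  by apply: fin_bigcup_measurable.
exists (\bigcup_(y in E) bowen_ball f n y (3 * e)); split => //.
apply: (@le_trans _ _ (\sum_(y \in E) mu (bowen_ball f n y (3 * e)))).
  exact: content_sub_fsum.
apply: (@le_trans _ _ (\sum_(y \in E)
    (expR (- d) ^+ n)%:E * (expR (- (a * ball_weight f u n y e)))%:E)).
  apply: lee_fsum => // y /ED[_].
  rewrite lt_lne_div ?measure_ge0//; last exact: (birkhoff_sum_gt0 f c0 cu).
  move=> /ltW/le_trans; apply; rewrite -EFinM lee_fin -expRM_natl -expRD ler_expR.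
  by have := ht y; lra.
rewrite -ge0_mule_fsumr => [|y]; last by rewrite lee_fin expR_ge0.
rewrite mulrC EFinM lee_pmul2l ?lte_fin ?exprn_gt0 ?expR_gt0//.
apply: le_trans hr.
pose G := (fun y => (y, n)) @` E.
have finG : finite_set G by exact: finite_image.
apply: (@le_trans _ _
  (\esum_(p in G) (expR (- (a * ball_weight f u p.2 p.1 e)))%:E)); last first.
  apply: ereal_sup_ubound; exists G => //; split.
  - exact: finite_set_countable.
  - by move=> _ [y Ey <-]/=; split => //; exact: (ED _ Ey).1.
  - by move=> _ _ [y Ey <-] [z Ez <-] yz; rewrite (tE _ _ Ey Ez yz).
rewrite esum_fset// (reindex_fsbig (fun y => (y, n)) E)//.
by split => [y Ey|y z _ _ [->]//|p [y Ey <-]]; exists y.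
Qed.

Lemma local_rate_le_ae_premeasure Z a e t d : (0 < e)%R -> (0 < d)%R ->
  (forall n y, a * ball_weight f u n y e + n%:R * d <= t * birkhoff_sum f u n y)%R ->
  packing_premeasure f u Z a e < +oo ->
  mu.-negligible [set x | Z x /\ t%:E < local_rate f u mu x (3 * e)].
Proof.
move=> e0 d0 ht /packing_premeasure_lty[N [r hr]].
have r0 : (0 <= r)%R by rewrite -lee_fin (le_trans _ hr)// packing_sup_ge0.
pose D n := [set x | Z x /\ t%:E < - lne (mu (bowen_ball f n x (3 * e)))
                           / (birkhoff_sum f u n x)%:E].
have exU n : exists U : set (borel X), [/\ measurable U,
    mu U <= (r * expR (- d) ^+ n)%:E & (0 < n)%N -> (N <= n)%N -> D n `<=` U].
  have [/andP[n0 Nn]|nN] := boolP ((0 < n) && (N <= n))%N.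
    by have [U [mU muU DU]] := mu_small_balls_le e0 n0 Nn (ht n) hr; exists U.
  exists set0; split => //; last by move=> n0 Nn; rewrite n0 Nn in nN.
  by rewrite measure0 lee_fin mulr_ge0// exprn_ge0// expR_ge0.
have [U UP] := choice exU.
exists (lim_sup_set U); split.
- apply: bigcapT_measurable => n; apply: bigcup_measurable => k _.
  by have [] := UP k.
- apply: lim_sup_set_cvg0 => [n|]; first by have [] := UP n.
  apply: (@le_lt_trans _ _ (r * (1 - expR (- d))^-1)%:E); last by rewrite ltry.
  apply: lime_le; first by apply: is_cvg_nneseries => n _ _; exact: measure_ge0.
  apply: nearW => n.
  apply: (@le_trans _ _ (\sum_(0 <= k < n) (r * expR (- d) ^+ k)%:E)).
    by apply: lee_sum => k _; have [] := UP k.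
  rewrite sumEFin lee_fin.
  have q1 : (`|expR (- d)| < 1)%R by rewrite ger0_norm ?expR_ge0// expR_lt1; lra.
  by have := geometric_le_lim n r0 (expR_gt0 (- d)%R) q1.
- move=> x [Zx xt] n _.
  have [k nk xk] := limn_esup_gt (maxn n (maxn N 1)) xt.
  rewrite !geq_max in nk; move: nk => /and3P[nk Nk k0].
  by exists k => //; have [_ _] := UP k; apply.
Qed.

Lemma local_rate_le_ae Z a e t d : (0 < e)%R -> (0 < d)%R ->
  (forall n y, a * ball_weight f u n y e + n%:R * d <= t * birkhoff_sum f u n y)%R ->
  thin f u Z a e ->
  mu.-negligible [set x | Z x /\ t%:E < local_rate f u mu x (3 * e)].
Proof.
move=> e0 d0 ht [Zs ZZs fZs].
have neg i := local_rate_le_ae_premeasure e0 d0 ht (fZs i).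
apply: negligibleS (negligible_bigcup neg).
by move=> x [/ZZs[i _ Zix] xt]; exists i.
Qed.

End UpperBound.

(** The integral of a function of unknown measurability is bounded through the
    simple functions below it. *)
Import HBNNSimple.

Lemma integral_le_of_negligible {d : measure_display} {T : measurableType d}
    {R : realType} (mu : {measure set T -> \bar R}) (g : T -> \bar R) (t : R) :
  mu setT = 1%E ->
  (forall x, 0 <= g x)%E -> 0 <= t ->
  mu.-negligible [set x | (t%:E < g x)%E] -> (\int[mu]_x g x <= t%:E)%E.
Proof.
move=> muT g0 t0 negl; rewrite ge0_integralTE//.
apply: ge_ereal_sup => _ [h /= hg <-]; rewrite -integralT_nnsfun.
apply: (@le_trans _ _ (\int[mu]_x (cst t%:E x))%E); last first.
  by rewrite integral_cst// muT mule1.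
apply: ae_ge0_le_integral => //.
- by move=> x _; rewrite lee_fin; exact: fun_ge0.
- by apply/measurable_EFinP; exact: measurable_funP.
- apply: negligibleS negl => x /= /not_implyP[_ /negP]; rewrite -ltNge.
  by move=> /lt_le_trans; apply; exact: hg.
Qed.

Section UpperBoundIntegral.
Context {R : realType} {X : pmetricType R}.
Variables (f : X -> X) (u : X -> R).
Hypotheses (Xcompact : compact [set: X]) (fcont : continuous f).
Hypotheses (ucont : continuous u) (upos : forall x, 0 < u x).
Local Open Scope ereal_scope.

(** On small balls the weight of a ball exceeds the Birkhoff sum at its center
    by a small multiple of the length only; this makes room for the strict
    increase of the exponent from [s] to [t]. *)
Lemma ball_weight_small (c s t : R) : (0 < c)%R -> (forall x, c <= u x)%R ->
  (0 < s < t)%R -> exists2 d, (0 < d)%R &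
  forall a e, (0 <= a <= s)%R -> (0 <= e <= d)%R -> forall n y,
    (a * ball_weight f u n y e + n%:R * ((t - s) * c / 2)
      <= t * birkhoff_sum f u n y)%R.
Proof.
move=> c0 cu /andP[s0 st]; pose h := ((t - s) * c / 2 / s)%R.
have h0 : (0 < h)%R by rewrite !divr_gt0// mulr_gt0// subr_gt0.
have [_ [M [_ _ uM]]] := compact_positive_bounds Xcompact ucont upos.
have [d d0 dP] := compact_uniform_modulus Xcompact ucont h0.
exists d => // a e /andP[a0 as_] /andP[e0 ed] n y.
have wS : (ball_weight f u n y e <= birkhoff_sum f u n y + n%:R * h)%R.
  apply: (ball_weight_le uM) => // z yz.
  rewrite mulr_natl -[n in (h *+ n)%R]card_ord -sumr_const -big_split/=.
  apply: ler_sum => i _; rewrite -lerBlDl; apply: le_trans (ler_norm _) _.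
  rewrite distrC; apply: dP; apply: le_trans ed.
  exact: (elimT (bowen_dist_leP _ _ _ _ e0) yz).
have w0 : (0 <= ball_weight f u n y e)%R.
  by apply: le_trans (ball_weight_ge f cu uM n y e0); rewrite mulr_ge0// ltW.
have aw : (a * ball_weight f u n y e <= s * (birkhoff_sum f u n y + n%:R * h))%R.
  by apply: le_trans (ler_wpM2r w0 as_) _; rewrite ler_pM2l.
have -> : ((t - s) * c / 2 = s * h)%R by rewrite /h mulrCA divff ?mulr1// gt_eqF.
have sh : (s * (n%:R * h) = n%:R * ((t - s) * c / 2))%R.
  by rewrite /h; field; rewrite gt_eqF.
have Sc := birkhoff_sum_ge f cu n y.
have : ((t - s) * (n%:R * c) <= (t - s) * birkhoff_sum f u n y)%R.
  by rewrite ler_pM2l// subr_gt0.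
have e1 : (n%:R * (s * h) = s * (n%:R * h))%R by ring.
rewrite e1; rewrite mulrDr in aw; rewrite sh in aw *; lra.
Qed.

Lemma upper_BS_le_dimBSP (mu : probability (borel X) R) (K : set X) :
  measurable (K : set (borel X)) -> mu K = 1 ->
  upper_BS f u mu <= dimBSP f u K.
Proof.
move=> mK muK.
have [c [M [c0 cu uM]]] := compact_positive_bounds Xcompact ucont upos.
have := dimBSP_ge0 f c0 cu uM K.
case dimK : (dimBSP f u K) => [r| |]//; last by move=> _; rewrite leey.
rewrite lee_fin => r0; apply/lee_addgt0Pr => d d0; rewrite -EFinD.
(* Thinness holds at an exponent below [s], and rates are bounded by [t > s]. *)
pose s := (r + d / 2)%R; pose t := (r + d)%R.
have s0 : (0 < s)%R by rewrite /s; lra.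
have st : (s < t)%R by rewrite /s /t; lra.
have [e0 e00 e0P] := ball_weight_small c0 cu (introT andP (conj s0 st)).
(* The local rates are controlled at the radii [3 * e k <= k.+1%:R^-1]. *)
pose e k : R := (Num.min e0 (3 * k.+1%:R)^-1)%R.
have ek0 k : (0 < e k)%R by rewrite lt_min e00 invr_gt0 mulr_gt0.
have neg k : mu.-negligible [set x | K x /\ t%:E < local_rate f u mu x (3 * e k)].
  have : dimBSP_at f u K (e k) < s%:E.
    apply: (@le_lt_trans _ _ r%:E); last by rewrite lte_fin /s; lra.
    rewrite -dimK (dimBSPE f c0 cu uM); apply: ereal_sup_ubound.
    by exists (e k); first exact: ek0.
  move=> /dimBSP_at_thin[a /andP[a0 a_s] thinK].
  apply: (local_rate_le_ae (d := ((t - s) * c / 2)%R)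
    Xcompact fcont c0 cu _ (ek0 k) _ _ thinK) => [|n y].
    by rewrite divr_gt0// mulr_gt0// subr_gt0.
  apply: e0P; first by rewrite !ltW.
  by rewrite (ltW (ek0 k)) ge_min lexx.
have nK : mu.-negligible (~` K : set (borel X)).
  apply/negligibleP; first exact: measurableC.
  by have := probability_setC mu mK; rewrite muK subee.
apply: integral_le_of_negligible => [|x||].
- exact: probability_setT.
- exact: (upper_local_BS_ge0 c0 cu fcont).
- by rewrite /t; lra.
apply: negligibleS (negligibleU nK (negligible_bigcup neg)) => x /= tx.
have [Kx|] := pselect (K x); last by left.
right; apply: contrapT => nx; move: tx; rewrite ltNge => /negP; apply.
rewrite (upper_local_BSE c0 cu fcont); apply: ge_ereal_sup => _ [e' /= e'0 <-].
pose k := Num.truncn e'^-1.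
have ke : (3 * e k <= e')%R.
  have : (e'^-1 < k.+1%:R)%R by exact: truncnS_gt.
  rewrite invf_plt ?posrE// => ke.
  apply: (@le_trans _ _ (k.+1%:R^-1)%R); last exact: ltW.
  apply: (@le_trans _ _ (3 * (3 * k.+1%:R)^-1)%R).
    by rewrite ler_pM2l// ge_min lexx orbT.
  by rewrite invfM mulrA divff ?mul1r.
apply: (@le_trans _ _ (local_rate f u mu x (3 * e k))).
  by apply: (local_rate_antitone c0 cu fcont); rewrite ke mulr_gt0.
rewrite leNgt; apply/negP => tx; apply: nx; exists k => //.
Qed.

End UpperBoundIntegral.

(** * The tree of disjoint cells *)

(** A node of the tree is a word, selecting a piece of the scheme of sets, a
    center, a radius, the length of a Bowen ball and a weight. *)
Notation node R X := (seq nat * X * R * nat * R)%type.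

Section Node.
Context {R : realType} {X : pmetricType R}.
Implicit Types s t : node R X.

Definition nword s : seq nat := s.1.1.1.1.
Definition ncenter s : X := s.1.1.1.2.
Definition nradius s : R := s.1.1.2.
Definition nlen s : nat := s.1.2.
Definition nweight s : R := s.2.
Definition ncell s : set X := [set z | mdist (ncenter s) z <= nradius s].

End Node.

(** Finitely many eventual properties hold eventually together. *)
Lemma near_forall_seq {T : eqType} {I : Type} (F : set_system I) (s : seq T)
    (Q : T -> I -> Prop) : Filter F ->
  (forall p, p \in s -> \forall i \near F, Q p i) ->
  \forall i \near F, forall p, p \in s -> Q p i.
Proof.
move=> FF; elim: s => [_|p s IH sQ]; first by apply: filterE.
have Qp := sQ p (mem_head _ _).
have Qs : \forall i \near F, forall q, q \in s -> Q q i.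
  by apply: IH => q qs; apply: sQ; rewrite inE qs orbT.
apply: filterS2 Qp Qs => i Qp Qs q; rewrite inE => /predU1P[->//|]; exact: Qs.
Qed.

Section Tree.
Context {R : realType} {X : pmetricType R}.
Variables (f : X -> X) (u : X -> R) (a e : R) (h : seq nat -> set X).
Hypotheses (Xcompact : compact [set: X]) (fcont : continuous f).
Hypothesis e0 : 0 < e.
Hypothesis hsub : forall l, h l `<=` \bigcup_k h (rcons l k).
Implicit Types s t : node R X.

Lemma thin_countable_bigcup {I : Type} (D : set I) (F : I -> set X) :
  countable D -> (forall i, D i -> thin f u (F i) a e) ->
  thin f u (\bigcup_(i in D) F i) a e.
Proof.
move=> /countable_injP[g ginj] Fthin.
apply: (@thin_sub _ _ _ _ _
  (\bigcup_n \bigcup_(i in [set i | D i /\ g i = n]) F i)).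
  by move=> x [i Di Fix]; exists (g i) => //; exists i.
apply: thin_bigcup => n.
have [[i [Di gi]]|nD] := pselect (exists i, D i /\ g i = n).
  apply: (@thin_sub _ _ _ _ _ (F i)); last exact: Fthin.
  move=> x [j [Dj gj]]; suff -> : j = i by [].
  by apply: (ginj _ _ (mem_set Dj) (mem_set Di)); rewrite gj gi.
apply: (@thin_sub _ _ _ _ _ set0); last exact: thin_set0.
by move=> x [j Dj _]; apply: nD; exists j.
Qed.

(** The points of a non-thin set near which one piece of the next generation is
    non-thin at every scale carry the whole set up to a thin one. *)
Lemma not_thin_core (l : seq nat) (S : set X) : S `<=` h l -> ~ thin f u S a e ->
  exists S', [/\ S' `<=` S, ~ thin f u S' a e & forall x, S' x ->
    exists k, forall r, 0 < r -> ~ thin f u (h (rcons l k) `&` ball x r) a e].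
Proof.
move=> Sl nS; have [B Bcount [Bopen Bbase]] := compact_second_countable Xcompact.
pose D k := [set V | B V /\ thin f u (h (rcons l k) `&` V) a e].
pose bad := \bigcup_k \bigcup_(V in D k) (h (rcons l k) `&` V).
have thin_bad : thin f u bad a e.
  apply: thin_bigcup => k; apply: thin_countable_bigcup => [|V []//].
  by apply: sub_countable Bcount; apply: subset_card_le => V [].
exists (S `\` bad); split => [x []//|S'thin|x [Sx badx]].
  apply: nS; apply: (thin_sub _ (thin_setU S'thin thin_bad)) => x Sx.
  by have [?|?] := pselect (bad x); [right|left].
have [k _ hx] := hsub (Sl _ Sx); exists k => r r0 thin_r; apply: badx.
have : nbhs x (ball x r) by exact: nbhsx_ballx.
move=> /Bbase[V [BV Vx] Vr]; exists k => //; exists V => //; split => //.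
by apply: thin_sub thin_r => z [hz /Vr].
Qed.

(** A node is good when its piece is non-thin inside its ball, so that the
    construction can be continued there. *)
Definition good_node s :=
  0 < nradius s /\
  ~ thin f u (h (nword s) `&` ball (ncenter s) (nradius s)) a e.

(** A child refines the word by one letter, lies inside the cell of its parent,
    carries a longer Bowen ball containing its own cell, and has the weight of
    that ball as it occurs in the packing sums. *)
Definition child s t := [/\ exists k, nword t = rcons (nword s) k,
  ncell t `<=` ncell s, nradius t <= nradius s / 2, (nlen s < nlen t)%N &
  nweight t = expR (- (a * ball_weight f u (nlen t) (ncenter t) e)) /\
  ncell t `<=` bowen_cball f (nlen t) (ncenter t) e].

(** Points of separated cells are at distance at least [e] in both of the Bowen
    metrics attached to the cells. *)
Definition bowen_separated s t := forall z z', ncell s z -> ncell t z' ->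
  ~ bowen_ball f (nlen s) z e z' /\ ~ bowen_ball f (nlen t) z e z'.

(** Disjointness of closed balls gives a strict inequality between centers, which
    survives a small perturbation of both points. *)
Lemma near_separated (p q : X * nat) : e < bowen_dist f p.2 p.1 q.1 ->
  \forall r \near 0^'+, forall z z', mdist p.1 z <= r -> mdist q.1 z' <= r ->
    ~ bowen_ball f p.2 z e z'.
Proof.
move=> pq; pose d := (bowen_dist f p.2 p.1 q.1 - e) / 2.
have d0 : 0 < d by rewrite divr_gt0// subr_gt0.
apply: filterS2 (near_bowen_dist fcont p.2 p.1 d0)
  (near_bowen_dist fcont p.2 q.1 d0) => r pr qr z z' /pr pz /qr qz'.
rewrite /bowen_ball/= => zz'.
have := bowen_dist_triangle f p.2 p.1 z q.1.
have := bowen_dist_triangle f p.2 z z' q.1.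
by rewrite (bowen_dist_sym f p.2 z' q.1); move: pz qz'; rewrite /d; lra.
Qed.

(** A non-thin set has infinite packing premeasure; a finite subfamily of a
    packing already has large total weight. *)
Lemma ex_packing_gt (S : set X) (N : nat) (W : R) : ~ thin f u S a e ->
  exists s : seq (X * nat), [/\ uniq s,
    forall p, p \in s -> S p.1 /\ (N <= p.2)%N,
    forall p q, p \in s -> q \in s -> p != q -> e < bowen_dist f p.2 p.1 q.1 &
    W < \sum_(p <- s) expR (- (a * ball_weight f u p.2 p.1 e))].
Proof.
move=> nS; have : (W%:E < packing_sup f u S a e N)%E.
  rewrite ltNge; apply/negP => SN; apply: nS; exists (fun=> S).
    by move=> x Sx; exists 0%N.
  move=> _; rewrite packing_premeasureE; apply: le_lt_trans (ltry W).
  by apply: le_trans SN; apply: ereal_inf_lbound; exists N.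
move=> /ereal_sup_gt[_ [G [cG SG tG] <-]] /ereal_sup_gt[_ [A [finA AG] <-]].
rewrite fsbig_finite//= sumEFin lte_fin => WA.
have memA p : p \in finmap.enum_fset (fset_set A) -> A p.
  by move=> pA; apply: set_mem; rewrite -(in_fset_set finA p); exact: pA.
exists (finmap.enum_fset (fset_set A)); split => //.
- exact: finmap.fset_uniq.
- by move=> p /memA/AG/SG.
- move=> p q /memA/AG Gp /memA/AG Gq pq; rewrite ltNge; apply/negP => dpq.
  move/eqP : pq; apply; apply: tG => //; exists q.1; split => //.
  by rewrite /bowen_cball/= bowen_distxx ltW.
Qed.

(** Every good node has finitely many separated good children whose total
    weight is at least its own. *)
Lemma ex_children s : good_node s ->
  exists (n : nat) (c : nat -> node R X), [/\
    forall i, (i < n)%N -> good_node (c i) /\ child s (c i),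
    forall i j, (i < n)%N -> (j < n)%N -> i != j -> bowen_separated (c i) (c j) &
    nweight s <= \sum_(0 <= i < n) nweight (c i)].
Proof.
move=> [g0 nS]; have [S' [S'S nS' S'k]] := not_thin_core (@subIsetl _ _ _) nS.
have [ps [ups psS' psep psW]] := ex_packing_gt (nlen s).+1 (nweight s) nS'.
have [k kP] : exists k : X * nat -> nat, forall p, p \in ps -> forall r, 0 < r ->
    ~ thin f u (h (rcons (nword s) (k p)) `&` ball p.1 r) a e.
  have kex p : exists k, p \in ps -> forall r, 0 < r ->
      ~ thin f u (h (rcons (nword s) k) `&` ball p.1 r) a e.
    have [pps|] := boolP (p \in ps); last by exists 0%N.
    by have [k kp] := S'k _ (psS' _ pps).1; exists k.
  by have [k kP] := choice kex; exists k.
pose good_radius r := [/\ r <= nradius s / 2,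
  forall p, p \in ps -> r <= nradius s - mdist (ncenter s) p.1,
  forall p, p \in ps -> forall z, mdist p.1 z <= r -> bowen_dist f p.2 p.1 z <= e &
  forall p, p \in ps -> forall q, q \in ps -> p != q -> forall z z',
    mdist p.1 z <= r -> mdist q.1 z' <= r -> ~ bowen_ball f p.2 z e z'].
have [r r0 [rg rnest rball rsep]] : exists2 r, 0 < r & good_radius r.
  apply: near0r_ex; near=> r; split; near: r.
  - by apply: nbhs_right_le; rewrite divr_gt0.
  - apply: near_forall_seq => p /psS'[/S'S[_ sp] _]; apply: nbhs_right_le.
    by rewrite subr_gt0; move: sp; rewrite ballEmdist.
  - by apply: near_forall_seq => p _; exact: near_bowen_dist.
  - apply: near_forall_seq => p pps; apply: near_forall_seq => q qps.
    have [->|pq] := eqVneq p q; first exact: filterE.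
    by apply: filterS (near_separated (psep _ _ pps qps pq)) => r sepr _.
pose p0 : X * nat := (point, 0%N).
pose w (p : X * nat) := expR (- (a * ball_weight f u p.2 p.1 e)).
pose c i := let p := nth p0 ps i in
  (rcons (nword s) (k p), p.1, r, p.2, w p) : node R X.
exists (size ps), c; split => [i ip|i j ip jp ij|].
- have pps : nth p0 ps i \in ps by exact: mem_nth.
  split; first by split => //; exact: kP.
  split => //.
  + by exists (k (nth p0 ps i)).
  + move=> z /= cz; rewrite /ncell/=.
    apply: le_trans (metric_triangle _ (nth p0 ps i).1 _) _.
    by have := rnest _ pps; move: cz; rewrite /ncell/=/ncenter/nradius/=; lra.
  + by have [] := psS' _ pps.
  + by split => // z; exact: rball.
- have ppi : nth p0 ps i \in ps by exact: mem_nth.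
  have ppj : nth p0 ps j \in ps by exact: mem_nth.
  have pij : nth p0 ps i != nth p0 ps j by rewrite nth_uniq.
  move=> z z' iz jz'; split; first exact: (rsep _ ppi _ ppj).
  rewrite /bowen_ball/= bowen_dist_sym.
  by apply: (rsep _ ppj _ ppi); rewrite 1?eq_sym.
- by apply: ltW; move: psW; rewrite (big_nth p0).
Unshelve. all: by end_near. Qed.

End Tree.

(** * A measure carried by the infinite branches of the tree *)

(** Lebesgue measure on the unit interval: the source of mass, distributed along
    the tree by cutting intervals. *)
Definition unit_measure (R : realType) :=
  mrestr (@lebesgue_measure R) (measurable_itv `[0, 1[) :
    set (measurableTypeR R) -> \bar R.
Arguments unit_measure : clear implicits.

HB.instance Definition _ (R : realType) := Measure.on (unit_measure R).

Lemma unit_measure_setT (R : realType) : unit_measure R setT = 1%E.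
Proof.
rewrite /unit_measure /mrestr setTI; apply: etrans (lebesgue_measure_itv _) _.
by rewrite /= lte01 oppr0 adde0.
Qed.

HB.instance Definition _ (R : realType) :=
  Measure_isProbability.Build _ _ R (unit_measure R) (unit_measure_setT R).

(** The first index whose right end exceeds [t] names the interval of [t]. *)
Lemma find_cut {R : realType} (S : nat -> R) (n : nat) (t : R) :
  S 0%N <= t < S n ->
  let j := find (fun i => t < S i.+1) (iota 0 n) in
  (j < n)%N /\ S j <= t < S j.+1.
Proof.
move=> /andP[S0t tSn] /=; set p := fun i => _; set j := find p _.
have n0 : (0 < n)%N.
  by rewrite lt0n; apply: contraTneq tSn => ->; rewrite -leNgt.
have has_p : has p (iota 0 n).
  apply/hasP; exists n.-1; last by rewrite /p prednK.
  by rewrite mem_iota /= add0n prednK.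
have jn : (j < n)%N by move: has_p; rewrite has_find size_iota.
have := nth_find 0%N has_p; rewrite -/j nth_iota// add0n /p => tj.
split => //; rewrite tj andbT; case Ej : j => [|k] //.
have kj : (k < j)%N by rewrite Ej.
have := before_find 0%N kj; rewrite nth_iota ?add0n; last exact: ltn_trans jn.
by move=> /negbT; rewrite /p -leNgt.
Qed.

Section TreeMeasure.
Context {R : realType} {X : pmetricType R}.
Variables (f : X -> X) (u : X -> R) (a e : R) (h : seq nat -> set X).
Variables (kids : node R X -> nat) (kid : node R X -> nat -> node R X).
Variable root : node R X.
Hypotheses (Xcompact : compact [set: X]) (fcont : continuous f).
Hypotheses (e0 : 0 < e) (a0 : 0 <= a).
Local Notation good := (good_node f u a e h).
Hypothesis kidP : forall s i, good s -> (i < kids s)%N ->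
  good (kid s i) /\ child f u a e s (kid s i).
Hypothesis kid_sep : forall s i j, good s -> (i < kids s)%N -> (j < kids s)%N ->
  i != j -> bowen_separated f e (kid s i) (kid s j).
Hypothesis kids_weight : forall s, good s ->
  nweight s <= \sum_(0 <= i < kids s) nweight (kid s i).
Hypotheses (good_root : good root) (root_word : nword root = [::]).
Hypothesis root_weight : nweight root = 1.
Implicit Types (s : node R X) (r : node R X * R) (p q n : nat) (t : R).

(** A state is a node with the left end of an interval whose length is the
    weight of the node; [cut r] lists the ends of the consecutive intervals of
    the children, which cover the interval of [r] but may overshoot it, and
    [next r t] is the state of the child whose interval contains [t]. *)
Definition cut r i := r.2 + \sum_(0 <= j < i) nweight (kid r.1 j).
Definition next_kid r t := find (fun i => t < cut r i.+1) (iota 0 (kids r.1)).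
Definition state_kid r i := (kid r.1 i, cut r i).
Definition next r t := state_kid r (next_kid r t).

Fixpoint state p t := if p is p'.+1 then next (state p' t) t else (root, 0).

Definition snode p t := (state p t).1.

Lemma next_kidP r t : good r.1 -> r.2 <= t < r.2 + nweight r.1 ->
  (next_kid r t < kids r.1)%N /\
  cut r (next_kid r t) <= t < cut r (next_kid r t).+1.
Proof.
move=> gr /andP[rt tr]; apply: (@find_cut R (cut r)).
rewrite {1}/cut big_geq// addr0 rt/=; apply: lt_le_trans tr _.
by rewrite lerD2l kids_weight.
Qed.

Lemma stateP p t : 0 <= t < 1 -> good (snode p t) /\
  (state p t).2 <= t < (state p t).2 + nweight (snode p t).
Proof.
move=> t01; elim: p => [|p [gp tp]]; first by rewrite /snode/= root_weight add0r.
have [jn cj] := next_kidP gp tp; split; first exact: (kidP gp jn).1.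
by rewrite /snode/=; move: cj; rewrite {2}/cut big_nat_recr//= addrA.
Qed.

Lemma good_snode p t : 0 <= t < 1 -> good (snode p t).
Proof. by move=> /(stateP p)[]. Qed.

Lemma snode_child p t : 0 <= t < 1 ->
  child f u a e (snode p t) (snode p.+1 t).
Proof.
move=> t01; have [gp tp] := stateP p t01.
by have [jn _] := next_kidP gp tp; exact: (kidP gp jn).2.
Qed.

Lemma ncell_snode p q t : 0 <= t < 1 -> (p <= q)%N ->
  ncell (snode q t) `<=` ncell (snode p t).
Proof.
move=> t01 /subnK <-; elim: (q - p)%N => [//|k IH].
have [_ + _ _ _] := snode_child (k + p) t01.
by move=> /subset_trans; apply.
Qed.

Lemma nlen_snode p t : 0 <= t < 1 -> (p <= nlen (snode p t))%N.
Proof.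
move=> t01; elim: p => // p IH; apply: leq_ltn_trans IH _.
by have [] := snode_child p t01.
Qed.

Lemma nradius_snode p t : 0 <= t < 1 ->
  nradius (snode p t) <= nradius root * 2^-1 ^+ p.
Proof.
move=> t01; elim: p => [|p IH]; first by rewrite mulr1.
have [_ _ + _ _] := snode_child p t01; move=> /le_trans; apply.
by rewrite exprSr mulrA ler_pM2r.
Qed.

Lemma near_nradius_snode (d : R) : 0 < d ->
  exists N, forall p t, 0 <= t < 1 -> (N <= p)%N -> nradius (snode p t) < d.
Proof.
move=> d0; have half1 : `|2^-1| < 1 :> R by rewrite ger0_norm// invf_lt1// ltr1n.
have := cvg_geometric (nradius root) half1.
move=> /cvgrPdist_lt/(_ _ d0)[N _ NP]; exists N => p t t01 /NP/=.
rewrite sub0r normrN => /ltr_normlW; apply: le_lt_trans.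
exact: nradius_snode.
Qed.

(** Points in the cells of a level which are close in the Bowen metric of that
    level lie in the same cell. *)
Lemma state_inj p t t' z z' : 0 <= t < 1 -> 0 <= t' < 1 ->
  ncell (snode p t) z -> ncell (snode p t') z' ->
  bowen_ball f (nlen (snode p t)) z e z' -> state p t = state p t'.
Proof.
move=> t01 t'01; elim: p => [//|p IH] pz pz' zz'.
have [_ cpz _ len _] := snode_child p t01.
have [_ cpz' _ _ _] := snode_child p t'01.
have st : state p t = state p t'.
  apply: IH; [exact: cpz|exact: cpz'|].
  by apply: le_lt_trans zz'; apply: bowen_dist_homo; exact: ltnW.
have [gp tp] := stateP p t01; have [_ tp'] := stateP p t'01.
move: pz pz' zz'; rewrite /snode/= -st /next.
rewrite /snode -st in tp'; rewrite /snode in tp gp.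
have [jn _] := next_kidP gp tp; have [j'n _] := next_kidP gp tp'.
have [->//|jj'] := eqVneq (next_kid (state p t) t) (next_kid (state p t) t').
by move=> pz pz' zz'; have [] := kid_sep gp jn j'n jj' pz pz'.
Qed.

(** The states reached at level [p]; there are finitely many of them. *)
Definition states p := state p @` [set t | 0 <= t < 1].

Lemma finite_states p : finite_set (states p).
Proof.
elim: p => [|p IH].
  by apply: (@sub_finite_set _ _ [set (root, 0)]) => // r [t _ <-].
apply: (@sub_finite_set _ _
    (\bigcup_(r in states p) (state_kid r @` `I_(kids r.1)))).
  move=> _ [t t01 <-]; exists (state p t); first by exists t.
  have [gp tp] := stateP p t01.
  by exists (next_kid (state p t) t) => //; have [] := next_kidP gp tp.
by apply: bigcup_finite => // r _; apply: finite_image; exact: finite_II.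
Qed.

Lemma cut_homo r i j : good r.1 -> (i <= j)%N -> (j <= kids r.1)%N ->
  cut r i <= cut r j.
Proof.
move=> gr ij jn; rewrite /cut lerD2l (big_cat_nat (leq0n i) ij)//= lerDl.
rewrite big_nat_cond; apply: sumr_ge0 => k; rewrite andbT => /andP[_ kj].
have [_ [_ _ _ _ [-> _]]] := kidP gr (leq_trans kj jn).
exact: expR_ge0.
Qed.

Lemma next_kidE r t i : good r.1 -> r.2 <= t < r.2 + nweight r.1 ->
  (i < kids r.1)%N -> (next_kid r t == i) = (cut r i <= t < cut r i.+1).
Proof.
move=> gr rt i_n; have [jn /andP[jt tj]] := next_kidP gr rt.
apply/eqP/idP => [<-|/andP[it ti]]; first by rewrite jt.
have [ij|ji|//] := ltngtP (next_kid r t) i.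
- have := lt_le_trans tj (le_trans (cut_homo gr ij (ltnW i_n)) it).
  by rewrite ltxx.
- have := lt_le_trans ti (le_trans (cut_homo gr ji (ltnW jn)) jt).
  by rewrite ltxx.
Qed.

Lemma measurable_state_eq p r :
  measurable ([set t | 0 <= t < 1 /\ state p t = r] : set (measurableTypeR R)).
Proof.
elim: p r => [|p IH] r.
  have [->|r0] := eqVneq r (root, 0).
    rewrite (_ : [set _ | _] = `[0, 1[%classic); first exact: measurable_itv.
    by apply/seteqP; split => [t []|t]; rewrite /= in_itv.
  rewrite (_ : [set _ | _] = set0)// -subset0 => t [_] /=.
  by move=> rE; move: r0; rewrite rE eqxx.
pose E r' i := [set t | 0 <= t < 1 /\ state p t = r'] `&`
  `[cut r' i, cut r' i.+1[%classic.
rewrite (_ : [set _ | _] = \bigcup_(r' in states p)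
    \bigcup_(i in [set i | (i < kids r'.1)%N /\ state_kid r' i = r]) E r' i).
  apply: fin_bigcup_measurable; first exact: finite_states.
  move=> r' _; apply: fin_bigcup_measurable => [|i _].
    apply: (@sub_finite_set _ _ `I_(kids r'.1)); first by move=> i [].
    exact: finite_II.
  by apply: measurableI; [exact: IH|exact: measurable_itv].
apply/seteqP; split => t.
  move=> [t01 <-]; have [gp tp] := stateP p t01.
  have [jn cj] := next_kidP gp tp.
  exists (state p t); first by exists t.
  by exists (next_kid (state p t) t) => //; split => //; rewrite /= in_itv.
move=> [r' _ [i [i_n <-] [[t01 tr']]]]; rewrite /= in_itv/= => cut_t.
split => //; have [gp tp] := stateP p t01; rewrite /snode tr' in gp tp.
by rewrite tr' /next; congr state_kid; apply/eqP; rewrite next_kidE.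
Qed.

Lemma measurable_state p (P : set (node R X * R)) :
  measurable ([set t | 0 <= t < 1 /\ P (state p t)] : set (measurableTypeR R)).
Proof.
rewrite (_ : [set _ | _] = \bigcup_(r in states p `&` P)
    [set t : R | 0 <= t < 1 /\ state p t = r]).
  apply: fin_bigcup_measurable => [|r _]; last exact: measurable_state_eq.
  by apply: sub_finite_set (finite_states p) => r [].
apply/seteqP; split => [t [t01 Pt]|t [r [_ Pr] [t01 tr]]];
  last by split => //; rewrite tr.
by exists (state p t) => //; split => //; exists t.
Qed.

Lemma ncell_center s : good s -> ncell s (ncenter s).
Proof. by move=> [s0 _]; rewrite /ncell/= mdistxx ltW. Qed.

Lemma closed_ncell s : closed (ncell s).
Proof.
rewrite -openC openE => z /= /negP; rewrite -ltNge => sz.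
rewrite /interior -nbhs_ballE/=; exists (mdist (ncenter s) z - nradius s) => /=.
  by rewrite subr_gt0.
move=> w; rewrite ballEmdist/= => zw; rewrite /ncell/= => sw.
have := metric_triangle (ncenter s) w z; rewrite (metric_sym w z).
by move: sw zw; lra.
Qed.

Lemma ex_limit t : 0 <= t < 1 -> exists z, forall p, ncell (snode p t) z.
Proof.
move=> t01; pose y p := ncenter (snode p t).
have [z [_ zy]] := Xcompact (fmap_proper_filter y _) (filterT (F := y @ \oo)).
exists z => p; apply: (closed_ncell (s := snode p t)) => B zB.
apply: zy => //; exists p => // q /= pq.
by apply: (ncell_snode t01 pq); apply/ncell_center/good_snode.
Qed.

(** The branch of the tree followed by [t] in the unit interval shrinks to the
    point [limit t]; parameters outside the unit interval are sent to [0]. *)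
Definition clamp t := if 0 <= t < 1 then t else 0.
Definition limit t : X := get [set z | forall p, ncell (snode p (clamp t)) z].

Lemma clamp01 t : 0 <= clamp t < 1.
Proof. by rewrite /clamp; case: ifPn => // _; rewrite lexx ltr01. Qed.

Lemma clamp_id t : 0 <= t < 1 -> clamp t = t.
Proof. by rewrite /clamp => ->. Qed.

Lemma limitP p t : ncell (snode p (clamp t)) (limit t).
Proof.
have [z zP] := ex_limit (clamp01 t).
by rewrite /limit; case: xgetP => [w -> //|/(_ z)]; exact.
Qed.

Lemma measurable_limit : measurable_fun setT (limit : measurableTypeR R -> borel X).
Proof.
apply: (@measurability _ _ _ (borel X) setT limit (@open X)) => // _ [U Uopen <-].
rewrite setTI.
(* The limit is in an open set exactly when some cell of its branch is. *)
pose P (r : node R X * R) := ncell r.1 `<=` U.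
pose E := \bigcup_p [set t : R | 0 <= t < 1 /\ P (state p t)].
have mE : measurable (E : set (measurableTypeR R)).
  by apply: bigcup_measurable => p _; exact: measurable_state.
have EP t : 0 <= t < 1 -> E t <-> U (limit t).
  move=> t01; split => [[p _ [_]]|Ut].
    by apply; have := limitP p t; rewrite clamp_id.
  have : nbhs (limit t) U by rewrite nbhsE; exists U.
  rewrite -filter_from_ballE => -[d d0 dU].
  have [N NP] := near_nradius_snode (divr_gt0 d0 (ltr0n R 2)).
  exists N => //; split => // z Nz; apply: dU; rewrite ballEmdist/=.
  have := NP _ _ t01 (leqnn N); have := limitP N t; rewrite clamp_id//.
  move: Nz; rewrite /ncell/= /snode => Nz Nl Nd.
  apply: le_lt_trans (metric_triangle _ (ncenter (state N t).1) _) _.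
  by rewrite (metric_sym (limit t)); lra.
have [U0|U0] := pselect (U (limit 0)).
  rewrite (_ : _ @^-1` _ = E `|` ~` `[0, 1[%classic).
    by apply: measurableU => //; apply: measurableC; exact: measurable_itv.
  apply/seteqP; split => t /=.
    have [t01|t01] := boolP (0 <= t < 1); last by right; rewrite in_itv; exact/negP.
    by left; exact/EP.
  have [t01 [/EP|]|t01 _] := boolP (0 <= t < 1); first exact.
    by rewrite in_itv/= t01.
  by move: U0; rewrite /limit /clamp (negbTE t01) lexx ltr01.
rewrite (_ : _ @^-1` _ = E)//; apply/seteqP; split => t /=.
  have [t01 /EP|t01 Ut] := boolP (0 <= t < 1); first exact.
  by exfalso; apply: U0; move: Ut; rewrite /limit /clamp (negbTE t01) lexx ltr01.
by move=> Et; apply/EP => //; case: Et => p _ [].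
Qed.

(** The distribution of the limit point of a uniformly chosen branch. *)
Definition tree_measure : probability (borel X) R :=
  distribution (unit_measure R) (mfun_Sub (mem_set measurable_limit)).

(** The points belonging to a cell of every level. *)
Definition tree_set := \bigcap_p \bigcup_(r in states p) ncell r.1.

Lemma closed_tree_set : closed tree_set.
Proof.
apply: closed_bigI => p _; apply: closed_bigcup => [|r _].
  exact: finite_states.
exact: closed_ncell.
Qed.

Lemma tree_setP z p : tree_set z ->
  exists2 t, 0 <= t < 1 & ncell (snode p t) z.
Proof. by move=> /(_ p Logic.I)[_ [t t01 <-] tz]; exists t. Qed.

Lemma tree_measure_tree_set : tree_measure tree_set = 1%E.
Proof.
have <- : tree_measure setT = 1%E by exact: probability_setT.
rewrite /tree_measure /distribution /pushforward; congr (unit_measure R _).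
rewrite preimage_setT; apply/seteqP; split => // t _ p _.
exists (state p (clamp t)); last exact: limitP.
by exists (clamp t) => //; exact: clamp01.
Qed.

Lemma tree_measure_bowen_ball z p t : 0 <= t < 1 -> ncell (snode p t) z ->
  (tree_measure (bowen_ball f (nlen (snode p t)) z e)
    <= (nweight (snode p t))%:E)%E.
Proof.
move=> t01 tz; set A := (state p t).2; set w := nweight _.
have [gp tp] := stateP p t01.
(* Any parameter whose limit is in the Bowen ball is in the state of [t]. *)
have sub : limit @^-1` (bowen_ball f (nlen (snode p t)) z e) `&` `[0, 1[%classic
    `<=` `[A, A + w[%classic.
  move=> t' []; rewrite /= !in_itv/= => zt' t'01.
  have lt' := limitP p t'; rewrite clamp_id// in lt'.
  have st := state_inj t01 t'01 tz lt' zt'.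
  by have [_] := stateP p t'01; rewrite /snode -st.
have mB : measurable (limit @^-1` (bowen_ball f (nlen (snode p t)) z e)
    : set (measurableTypeR R)).
  rewrite -[_ @^-1` _]setTI; apply: measurable_limit => //.
  exact: measurable_bowen_ball.
apply: (@le_trans _ _ (lebesgue_measure `[A, A + w[%classic)).
  apply: le_measure => //; rewrite inE; last exact: measurable_itv.
  by apply: measurableI => //; exact: measurable_itv.
have Aw : A < A + w by case/andP: tp => [/le_lt_trans]; apply.
by rewrite lebesgue_measure_itv/= lte_fin Aw -EFinD lee_fin addrAC subrr add0r.
Qed.

Lemma local_rate_tree_measure (c M : R) z : 0 < c ->
  (forall x, c <= u x) -> (forall x, u x <= M) ->
  tree_set z -> (a%:E <= local_rate f u tree_measure z e)%E.
Proof.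
move=> c0 cu uM Kz; apply: limn_esup_ge => N.
have [t t01 tz] := tree_setP N.+1 Kz.
have Nlen := nlen_snode N.+1 t01; exists (nlen (snode N.+1 t)).
  exact: ltnW.
rewrite le_lne_div ?measure_ge0//; last first.
  by apply: (birkhoff_sum_gt0 f c0 cu); exact: leq_ltn_trans Nlen.
apply: le_trans (tree_measure_bowen_ball t01 tz) _.
have [_ _ _ _ [-> cell_ball]] := snode_child N t01.
rewrite lee_fin ler_expR lerN2 ler_wpM2l//.
apply: (birkhoff_sum_le_ball_weight uM); first exact: ltW.
exact: cell_ball.
Qed.

Lemma tree_set_branch z : tree_set z -> exists (b : nat -> nat) (x : nat -> X),
  (forall p, h (mkseq b p) (x p)) /\ x @ \oo --> z.
Proof.
move=> Kz.
have ex_t p : exists t, 0 <= t < 1 /\ ncell (snode p t) z.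
  by have [t t01 tz] := tree_setP p Kz; exists t.
have [t tP] := choice ex_t.
have snodeE p : snode p (t p.+1) = snode p (t p).
  have [t01 tz] := tP p; have [t'01 t'z] := tP p.+1.
  have t'z' := ncell_snode t'01 (leqnSn p) t'z.
  rewrite /snode (state_inj t'01 t01 t'z' tz)//.
  exact: bowen_ballxx.
(* The node of level [p] whose cell contains [z] is unique, so these nodes
   form a branch and their words are the prefixes of one sequence. *)
pose b p := nth 0%N (nword (snode p.+1 (t p.+1))) p.
have bE p : nword (snode p (t p)) = mkseq b p.
  elim: p => [|p IH]; first by rewrite /snode/= root_word.
  have [[k kE] _ _ _ _] := snode_child p (tP p.+1).1.
  rewrite snodeE IH in kE; rewrite mkseqS kE; congr rcons.
  by rewrite /b kE nth_rcons size_mkseq ltnn eqxx.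
have ex_x p : exists x, h (mkseq b p) x /\
    mdist (ncenter (snode p (t p))) x < nradius (snode p (t p)).
  have [r0 thick] := good_snode p (tP p).1.
  apply: contrapT => empty; apply: thick.
  apply: (@thin_sub _ _ _ _ _ set0); last exact: thin_set0.
  move=> x [hx]; rewrite ballEmdist/= => px; apply: empty; exists x.
  by rewrite -bE.
have [x xP] := choice ex_x.
exists b, x; split => [p|]; first exact: (xP p).1.
apply/cvg_ballP => d d0.
have [N NP] := near_nradius_snode (divr_gt0 d0 (ltr0n R 2)).
exists N => // p /= Np; rewrite ballEmdist/=.
have := NP p _ (tP p).1 Np; have := (tP p).2; have := (xP p).2.
rewrite /ncell/= => px pz pd.
apply: le_lt_trans (metric_triangle _ (ncenter (snode p (t p))) _) _.
by rewrite (metric_sym z); lra.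
Qed.

End TreeMeasure.

(** A set of a scheme which is not thin at the exponent [a] supports, within the
    limits of the branches of the scheme, a measure of local rate at least [a]. *)
Lemma not_thin_measure {R : realType} {X : pmetricType R} (f : X -> X)
    (u : X -> R) (a e : R) (h : seq nat -> set X) :
  compact [set: X] -> continuous f -> continuous u -> (forall x, 0 < u x) ->
  0 < e -> 0 <= a -> (forall l, h l `<=` \bigcup_k h (rcons l k)) ->
  ~ thin f u (h [::]) a e ->
  exists (K : set X) (mu : probability (borel X) R), [/\ compact K, mu K = 1%E,
    forall z, K z -> (a%:E <= local_rate f u mu z e)%E &
    forall z, K z -> exists (b : nat -> nat) (x : nat -> X),
      (forall p, h (mkseq b p) (x p)) /\ x @ \oo --> z].
Proof.
move=> Xcompact fcont ucont upos e0 a0 hsub thick.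
have [c [M [c0 cu uM]]] := compact_positive_bounds Xcompact ucont upos.
have [m thick_m] : exists m : nat,
    ~ thin f u (h [::] `&` ball (point : X) m.+1%:R) a e.
  apply: contrapT => all_thin; apply: thick.
  apply: (@thin_sub _ _ _ _ _ (\bigcup_m (h [::] `&` ball (point : X) m.+1%:R))).
    move=> x hx; exists (Num.truncn (mdist (point : X) x)) => //; split => //.
    by rewrite ballEmdist/= truncnS_gt.
  apply: thin_bigcup => m; apply: contrapT => thick_m.
  by apply: all_thin; exists m.
(* The length of the root is not used as that of a ball: its weight is 1, the
   length of the unit interval. *)
pose root : node R X := ([::], point, m.+1%:R, 0%N, 1).
have good_root : good_node f u a e h root by split; first exact: ltr0n.
have ex_kk s : exists kk : nat * (nat -> node R X),
    good_node f u a e h s -> [/\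
    forall i, (i < kk.1)%N ->
      good_node f u a e h (kk.2 i) /\ child f u a e s (kk.2 i),
    forall i j, (i < kk.1)%N -> (j < kk.1)%N -> i != j ->
      bowen_separated f e (kk.2 i) (kk.2 j) &
    nweight s <= \sum_(0 <= i < kk.1) nweight (kk.2 i)].
  have [gs|] := pselect (good_node f u a e h s); last first.
    by exists (0%N, fun=> s).
  have [n [k nk]] := ex_children Xcompact fcont e0 hsub gs.
  by exists (n, k).
have [kk kkP] := choice ex_kk.
pose kids s := (kk s).1; pose kid s := (kk s).2.
have kidP s i : good_node f u a e h s -> (i < kids s)%N ->
    good_node f u a e h (kid s i) /\ child f u a e s (kid s i).
  by move=> /kkP[+ _ _]; exact.
have kid_sep s i j : good_node f u a e h s -> (i < kids s)%N ->
    (j < kids s)%N -> i != j -> bowen_separated f e (kid s i) (kid s j).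
  by move=> /kkP[_ + _]; exact.
have kids_weight s : good_node f u a e h s ->
    nweight s <= \sum_(0 <= i < kids s) nweight (kid s i).
  by move=> /kkP[].
have root_weight : nweight root = 1 by [].
exists (tree_set kids kid root).
exists (tree_measure Xcompact kidP kids_weight good_root root_weight).
split => [||z Kz|z Kz].
- apply: (subclosed_compact _ Xcompact) => //.
  exact: (closed_tree_set kidP kids_weight good_root root_weight).
- exact: tree_measure_tree_set.
- exact: (local_rate_tree_measure _ _ _ _ _ kid_sep _ _ _ c0 cu uM Kz).
- exact: (tree_set_branch e0 kidP kid_sep kids_weight good_root erefl
    root_weight Kz).
Qed.

(** * The variational principle *)

Section Variational.
Context {R : realType} {X : pmetricType R}.
Variables (f : X -> X) (u : X -> R).
Hypotheses (Xcompact : compact [set: X]) (fcont : continuous f).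
Hypotheses (ucont : continuous u) (upos : forall x, 0 < u x).
Local Open Scope ereal_scope.

Lemma compact_measurable_borel (K : set X) :
  compact K -> measurable (K : set (borel X)).
Proof.
move=> Kc; apply: closed_measurable_borel; apply: compact_closed Kc.
exact: metric_hausdorff.
Qed.

Lemma upper_BS_ge0 (mu : probability (borel X) R) : 0 <= upper_BS f u mu.
Proof.
have [c [M [c0 cu _]]] := compact_positive_bounds Xcompact ucont upos.
by apply: integral_ge0 => x _; exact: (upper_local_BS_ge0 c0 cu fcont).
Qed.

(** The multiple by [a] of the indicator of [K] is a simple function below the
    local rates, whether or not these are measurable. *)
Lemma upper_BS_ge (mu : probability (borel X) R) (K : set X) (a e : R) :
  measurable (K : set (borel X)) -> mu K = 1 -> (0 <= a)%R -> (0 < e)%R ->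
  (forall z, K z -> a%:E <= local_rate f u mu z e) -> a%:E <= upper_BS f u mu.
Proof.
move=> mK muK a0 e0 aK.
have [c [M [c0 cu _]]] := compact_positive_bounds Xcompact ucont upos.
rewrite /upper_BS ge0_integralTE => [|x]; last first.
  exact: (upper_local_BS_ge0 c0 cu fcont).
apply: ereal_sup_ubound; exists (scale_nnsfun (indic_nnsfun R mK) a0).
  move=> x /=; rewrite mindicE; have [xK|_] := boolP (x \in K); last first.
    by rewrite mulr0; exact: (upper_local_BS_ge0 c0 cu fcont).
  rewrite mulr1 (upper_local_BSE c0 cu fcont).
  apply: (le_trans (aK _ (set_mem xK))); apply: ereal_sup_ubound.
  by exists e.
rewrite -integralT_nnsfun.
rewrite (eq_integral (fun x => a%:E * (\1_(K : set (borel X)) x)%:E)); last first.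
  by move=> x _; rewrite -EFinM /= mindicE.
rewrite ge0_integralZl_EFin//; last exact/measurable_EFinP/measurable_indic.
by rewrite integral_indic// setIT (_ : _ K = 1) ?mule1.
Qed.

(** Any level below the dimension of the trunk of a scheme is exceeded by a
    measure on a compact set of limits of branches. *)
Lemma exists_measure_lt_dimBSP (h : seq nat -> set X) (Z : set X) (s : \bar R) :
  (forall l, h l `<=` \bigcup_k h (rcons l k)) ->
  (forall (b : nat -> nat) (x : nat -> X) z,
    (forall p, h (mkseq b p) (x p)) -> x @ \oo --> z -> Z z) ->
  0 <= s -> s < dimBSP f u (h [::]) ->
  exists (K : set X) (mu : probability (borel X) R),
    [/\ compact K, K `<=` Z, mu K = 1 & s < upper_BS f u mu].
Proof.
move=> hsub hlim s0.
have [c [M [c0 cu uM]]] := compact_positive_bounds Xcompact ucont upos.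
rewrite (dimBSPE f c0 cu uM) => /ereal_sup_gt[_ [e e0 <-]] sdim.
have [a /andP[a0 sa] adim] := ereal_between s0 sdim.
have thick : ~ thin f u (h [::]) a e.
  move=> hthin; move: adim; rewrite ltNge => /negP; apply.
  by apply: (thin_dimBSP_at c0 cu uM _ _ hthin) => //; exact: ltW.
have [K [mu [Kc muK Krate Kbranch]]] :=
  not_thin_measure Xcompact fcont ucont upos e0 (ltW a0) hsub thick.
exists K, mu; split => //.
  by move=> z /Kbranch[b [x [hx xz]]]; exact: hlim xz.
apply: lt_le_trans sa _; apply: upper_BS_ge (ltW a0) e0 Krate => //.
exact: compact_measurable_borel.
Qed.

End Variational.

(** Limits of branches of the scheme of the images of the cylinders of the Baire
    space stay in the analytic set. *)
Lemma cylinder_image_limit {R : realType} {X : metricType R}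
    (g : {ptws nat -> nat} -> X) (b : nat -> nat) (x : nat -> X) (z : X) :
  continuous g -> x @ \oo --> z ->
  (forall p, (g @` [set c | mkseq c p = mkseq b p]) (x p)) -> range g z.
Proof.
move=> gcont xz xb.
have ex_c p : exists c : {ptws nat -> nat}, mkseq c p = mkseq b p /\ g c = x p.
  by have [c cb gc] := xb p; exists c.
have [c cP] := choice ex_c.
have cb : c @ \oo --> (b : {ptws nat -> nat}).
  apply/cvg_sup => i U [V [[W oW <-] Wb WU]].
  exists i.+1 => // p /= ip; apply: WU => /=.
  have [/(congr1 (nth 0%N ^~ i))] := cP p.
  by rewrite !nth_mkseq// => -> _.
have gx : g \o c = x by apply/funext => p /=; have [] := cP p.
have xgb : x @ \oo --> g b.
  by rewrite -gx; apply: (@cvg_comp _ _ _ c g _ _ _ cb); exact: gcont.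
exists b => //; apply: (@cvg_unique _ _ (x @ \oo)) => //.
exact: metric_hausdorff.
Qed.

Theorem theorem3p12 (R : realType) (X : pmetricType R) (f : X -> X) (u : X -> R)
  (Xcompact : compact [set: X]) (fcont : continuous f)
  (ucont : continuous u) (upos : forall x, 0 < u x) :
  (forall K : set X, K !=set0 -> compact K ->
     dimBSP f u K =
     ereal_sup [set upper_BS f u mu
               | mu in [set mu : probability (borel X) R | mu K = 1%E]]) /\
  (forall Z : set X, analytic Z ->
     dimBSP f u Z =
     ereal_sup [set dimBSP f u K | K in [set K : set X | compact K /\ K `<=` Z]]).
Proof.
have [c [M [c0 cu uM]]] := compact_positive_bounds Xcompact ucont upos.
split => [K K0 Kc|Z [g gcont ->]].
- apply/eqP; rewrite eq_le; apply/andP; split; last first.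
    apply: ge_ereal_sup => _ [mu muK <-].
    exact: (upper_BS_le_dimBSP Xcompact fcont ucont upos
      (compact_measurable_borel Kc) muK).
  set s := ereal_sup _; have s0 : (0 <= s)%E.
    have [x Kx] := K0.
    apply: (le_trans (upper_BS_ge0 Xcompact fcont ucont upos (dirac (x : borel X)))).
    apply: ereal_sup_ubound; exists (dirac (x : borel X)) => //=.
    by rewrite diracE mem_set.
  rewrite leNgt; apply/negP => sdim.
  have [||K' [mu [K'c K'K muK' smu]]] := exists_measure_lt_dimBSP Xcompact fcont
    ucont upos (h := fun=> K) (Z := K) _ _ s0 sdim.
  - by move=> l x Kx; exists 0%N.
  - move=> b x z Kx xz; apply: (closed_cvg _ _ _ _ xz).
      by apply: compact_closed Kc; exact: metric_hausdorff.
    exact: nearW.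
  move: smu; rewrite ltNge => /negP; apply; apply: ereal_sup_ubound.
  exists mu => //=; apply/eqP; rewrite eq_le probability_le1; last first.
    exact: compact_measurable_borel.
  rewrite -muK' le_measure// inE; exact: compact_measurable_borel.
- apply/eqP; rewrite eq_le; apply/andP; split; last first.
    by apply: ge_ereal_sup => _ [K [_ KZ] <-]; exact: (dimBSP_subset f c0 cu uM).
  set s := ereal_sup _; have s0 : (0 <= s)%E.
    apply: (le_trans (dimBSP_ge0 f c0 cu uM set0)).
    by apply: ereal_sup_ubound; exists set0 => //; split => //; exact: compact0.
  rewrite leNgt; apply/negP => sdim.
  pose h l := g @` [set b | mkseq b (size l) = l].
  have hnil : h [::] = range g by congr (_ @` _); apply/seteqP; split.
  rewrite -hnil in sdim.
  have [||K [mu [Kc KZ muK smu]]] := exists_measure_lt_dimBSP Xcompact fcont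
    ucont upos (h := h) (Z := range g) _ _ s0 sdim.
  - move=> l _ [b bl <-]; exists (b (size l)) => //; exists b => //=.
    by rewrite size_rcons mkseqS bl.
  - move=> b x z hx xz; apply: (cylinder_image_limit (b := b) gcont xz) => p.
    by have := hx p; rewrite /h size_mkseq.
  move: smu; rewrite ltNge => /negP; apply.
  apply: (@le_trans _ _ (dimBSP f u K)).
    exact: (upper_BS_le_dimBSP Xcompact fcont ucont upos
      (compact_measurable_borel Kc) muK).
  by apply: ereal_sup_ubound; exists K.
Qed.
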